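(* Let $s\geq t>r\geq 2$ be fixed integers and let $H=H(n,s,p)$ with $p=p(n)$. Then: (i) For any $r$-graph $F$ with $e(F)\geq 2$, there is a constant $\delta>0$ such that, if $p\, n^{s-r+1/m_r(F)}\to\infty$ as $n\to\infty$, then with probability tending to $1$ as $n\to\infty$, $G[H_0,r]\to(K^{(r)}_s,F)$ holds for every $H_0\subseteq H$ with $e(H_0)\geq(1-\delta)e(H)$. (ii) If $p\,n^{s}\to\infty$ and $p\,n^{s-r+1/m_r(K^{(r)}_t)}\to 0$ as $n\to\infty$, then with probability tending to $1$ as $n\to\infty$ there is an $r$-linear $(r,t)$-conformal $H_0\subseteq H$ with $e(H_0)=(1-o(1))e(H)$.
   Context: An $r$-graph (resp. $s$-graph) is a pair $(V,E)$ with $E\subseteq\binom{V}{r}$ (resp. $\binom{V}{s}$). $K^{(r)}_t$ is the complete $r$-graph on $t$ vertices. $H(n,s,p)$ is the random $s$-graph on vertex set $[n]$ in which each $s$-subset of $[n]$ is an edge independently with probability $p$. For an $s$-graph $H$, its primal $r$-graph $G[H,r]$ has vertex set $V(H)$ and edge set $\{B\in\binom{A}{r}: A\in E(H)\}$. $H$ is $r$-linear if every $r$-subset of vertices lies in at most one edge of $H$; $H$ is $(r,t)$-conformal if for every copy of $K^{(r)}_t$ in $G[H,r]$ some edge of $H$ contains all of its vertices. For $r$-graphs $G,F_1,F_2$, $G\to(F_1,F_2)$ means every red-blue edge-coloring of $G$ contains a red copy of $F_1$ or a blue copy of $F_2$. For an $r$-graph $F$ with $e(F)\ge 2$, $m_r(F)=\max_{J\subseteq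 F,\,v(J)>r}\frac{e(J)-1}{v(J)-r}$. Subhypergraphs $H_0\subseteq H$ are on the same vertex set with $E(H_0)\subseteq E(H)$. In (ii), $e(H_0)=(1-o(1))e(H)$ means $e(H_0)\ge (1-\varepsilon(n))e(H)$ for some function $\varepsilon(n)\to 0$. *)

(* Defs.v *)
From mathcomp Require Import all_boot all_order all_algebra.
From mathcomp Require Import all_classical all_reals all_analysis.

Set Implicit Arguments.
Unset Strict Implicit.
Unset Printing Implicit Defensive.

Import Order.TTheory GRing.Theory Num.Theory.
Import numFieldNormedType.Exports.

Local Open Scope ring_scope.

(* A hypergraph with vertex set the finite type V is given by its edge set
   E : {set {set V}}; it is an r-graph when every edge has r vertices. *)
Definition uniform (r : nat) (V : finType) (E : {set {set V}}) : Prop :=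
  forall A, A \in E -> #|A| = r.

Definition complete (r t : nat) : {set {set 'I_t}} := [set A : {set 'I_t} | #|A| == r].

(* A copy is a not necessarily induced subgraph, given by an injection of the
   vertices of F; isolated vertices of F have to be embedded as well. *)
Definition is_copy (W V : finType) (F : {set {set W}}) (G : {set {set V}})
    (f : W -> V) : Prop :=
  injective f /\ forall A, A \in F -> f @: A \in G.

Definition contains_copy (W V : finType) (F : {set {set W}})
    (G : {set {set V}}) : Prop :=
  exists f : W -> V, is_copy F G f.

(* A colouring is a function c on all vertex subsets (true = red), of which
   only the values on the edges of G are used. *)
Definition arrows (V W1 W2 : finType) (G : {set {set V}})
    (F1 : {set {set W1}}) (F2 : {set {set W2}}) : Prop :=
  forall c : {set V} -> bool,
    contains_copy F1 [set A in G | c A] \/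
    contains_copy F2 [set A in G | ~~ c A].

Definition primal (r : nat) (V : finType) (H : {set {set V}}) :
    {set {set V}} :=
  [set B : {set V} | (#|B| == r) && [exists A in H, B \subset A]].

Definition linear_hgraph (r : nat) (V : finType) (H : {set {set V}}) : Prop :=
  forall B : {set V}, #|B| = r -> (#|[set A in H | B \subset A]| <= 1)%N.

Definition conformal (r t : nat) (V : finType) (H : {set {set V}}) : Prop :=
  forall f : 'I_t -> V, is_copy (complete r t) (primal r H) f ->
    exists2 A, A \in H & forall i, f i \in A.

(* m_r(F): the maximum over subgraphs J = (J.1, J.2) of F, with vertex set J.1
   and edge set J.2. The default value 0 of the maximum is irrelevant when
   e(F) >= 2, since J = F then contributes a positive value. *)
Definition m_density (R : realType) (r : nat) (W : finType)
    (F : {set {set W}}) : R :=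
  \big[Num.max/0]_(J : {set W} * {set {set W}} |
      [&& J.2 \subset F, [forall A in J.2, A \subset J.1] & (r < #|J.1|)%N])
    ((#|J.2|%:R - 1) / (#|J.1|%:R - r%:R)).

Definition Hnsp_mass (R : realType) (n s : nat) (p : R)
    (H : {set {set 'I_n}}) : R :=
  \prod_(A : {set 'I_n} | #|A| == s) (if A \in H then p else 1 - p).

(* The probability that the random s-graph H(n,s,p) belongs to the event X. *)
Definition Hnsp_prob (R : realType) (n s : nat) (p : R)
    (X : set {set {set 'I_n}}) : R :=
  \sum_(H : {set {set 'I_n}} | `[< uniform s H /\ X H >]) Hnsp_mass s p H.

Lemma Hnsp_prob_setT (R : realType) (n s : nat) (p : R) :
  Hnsp_prob s p [set: {set {set 'I_n}}]%classic = 1.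
Proof.
rewrite /Hnsp_prob.
pose P (A : {set 'I_n}) := #|A| == s.
transitivity (\prod_(A : {set 'I_n})
    ((if P A then p else 0) + (if P A then 1 - p else 1))); last first.
  by rewrite big1 // => A _; case: ifP; rewrite ?add0r // addrCA subrr addr0.
rewrite bigA_distr big_mkcond /=; apply: eq_bigr => H _.
case: ifPn => [/asboolP[uH _]|/asboolP nuH].
  rewrite /Hnsp_mass big_mkcond /=; apply: eq_bigr => A _; rewrite -/(P A).
  by case: ifPn => // nPA; case: ifPn => // /uH /eqP; rewrite -/(P A) (negbTE nPA).
have [A AH nPA] : exists2 A, A \in H & ~~ P A.
  apply: contrapT => h; apply: nuH; split=> // A AH; apply/eqP.
  by apply: contrapT => /negP nA; apply: h; exists A.
by rewrite (bigD1 A) //= AH (negbTE nPA) mul0r.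
Qed.

(* Main.v *)
Require Import Defs.
From mathcomp Require Import all_boot all_order all_algebra.
From mathcomp Require Import boolp.
From mathcomp Require Import zify ring lra.

(** Part (i).  If G[H0,r] does not arrow (K_s, F), then the blue r-sets of a bad
colouring form an F-free family B that meets every edge of H0 in at least one
blue r-set.  The hypergraph container theorem, applied to the hypergraph of
copies of F, puts B inside a set C with few copies of F, where C depends only
on a fingerprint of O(n^(r - 1/m_r(F))) members of B.  By Ramsey's theorem and
averaging, a positive proportion of all s-sets contain no r-set of C, and H0
contains none of them.  Every member of the fingerprint lies in an edge of H, so
one can sum over the sets of edges of H that cover a fingerprint; there are
o(p n^s) such edges, and a Chernoff bound then beats the union bound without
any logarithmic loss.

The containers are built without an algorithm.  From a weighted (k+1)-uniform
hypergraph w and an independent set I, choose S maximal in I such that the link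
of S carries a weight w' with controlled degrees and mass at least lambda |S|.
Either w' is heavy, and one recurses on this k-uniform weight, or the vertices v
for which S + v would still be admissible can be discarded, and the set that
remains contains I and carries little weight.

Part (ii).  Delete from H all edges that share at least r vertices with another
edge, and all edges taking part in a configuration of edges whose traces on a
t-set T cover each r-subset of T exactly once without containing T.  Since K_t is
r-balanced, the expected number of such configurations is at most
p n^(s-r+1/m_r(K_t)) times a constant multiple of p n^s. *)

Set Implicit Arguments.
Unset Strict Implicit.
Unset Printing Implicit Defensive.

Import Order.TTheory GRing.Theory Num.Theory.

Local Open Scope ring_scope.

(** * Ramsey's theorem and supersaturation *)

Definition monochromatic (T : finType) (r a : nat) (col : bool)
    (c : {set T} -> bool) (Y : {set T}) : Prop :=
  exists X : {set T}, [/\ X \subset Y, #|X| = a &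
    forall B : {set T}, B \subset X -> #|B| = r -> c B = col].

Lemma monochromatic_sub (T : finType) (r a : nat) (col : bool)
    (c : {set T} -> bool) (Y Z : {set T}) :
  Y \subset Z -> monochromatic r a col c Y -> monochromatic r a col c Z.
Proof. by move=> YZ [X [XY Xa Xc]]; exists X; rewrite (subset_trans XY). Qed.

(** An [r.+1]-subset of [x |: X] either avoids [x] and lies in [X], or is [x] together with an
    [r]-subset of [Y]; the two hypotheses on [c] settle the two cases. *)
Lemma monochromaticU1 (T : finType) (r a : nat) (col : bool)
    (c : {set T} -> bool) (x : T) (Y : {set T}) :
  x \notin Y ->
  (forall B : {set T}, B \subset Y -> #|B| = r -> c (x |: B) = col) ->
  monochromatic r.+1 a col c Y -> monochromatic r.+1 a.+1 col c (x |: Y).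
Proof.
move=> xY cx [X [XY Xa Xc]]; exists (x |: X); split.
- by rewrite setUS.
- by rewrite cardsU1 (contra (subsetP XY x)) // Xa.
move=> B BX Br; have [xB|xB] := boolP (x \in B); last first.
  apply: Xc => //; apply/subsetP => y yB; have := subsetP BX y yB.
  by rewrite !inE => /predU1P[yx|//]; rewrite -yx yB in xB.
rewrite -(setD1K xB); apply: cx.
  apply: subset_trans XY; apply/subsetP => y; rewrite !inE => /andP[yx yB].
  by have := subsetP BX y yB; rewrite !inE (negbTE yx).
by have := cardsD1 x B; rewrite xB Br add1n => -[].
Qed.

(** Induction on [r], then on [a + b]. Fix a vertex [x] and colour the [r]-subsets [B] of the
    remaining vertices by [c (x |: B)]. The sizes [Ma] and [Mb] are taken so large that a set
    homogeneous for this colouring still contains either a homogeneous set that [x] enlarges or one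
    of the other colour that is already big enough. *)
Lemma ramsey (r a b : nat) : exists M, forall (T : finType) (c : {set T} -> bool)
    (Y : {set T}), (M <= #|Y|)%N ->
  monochromatic r a true c Y \/ monochromatic r b false c Y.
Proof.
have pick (T : finType) (Y : {set T}) k : (k <= #|Y|)%N -> exists2 X : {set T}, X \subset Y & #|X| = k.
  case: (posnP k) => [-> _|k0 kY]; first by exists set0; rewrite ?sub0set ?cards0.
  have : (0 < #|[set X : {set T} | X \subset Y & #|X| == k]|)%N.
    by rewrite cards_draws bin_gt0.
  by move=> /card_gt0P[X]; rewrite inE => /andP[XY /eqP Xk]; exists X.
elim: r a b => [|r IHr] a b.
  exists (maxn a b) => T c Y; rewrite geq_max => /andP[aY bY].
  have [cT|cF] := boolP (c set0).
  - have [X XY Xa] := pick _ _ _ aY; left; exists X; split=> // B _ /eqP.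
    by rewrite cards_eq0 => /eqP ->.
  - have [X XY Xa] := pick _ _ _ bY; right; exists X; split=> // B _ /eqP.
    by rewrite cards_eq0 => /eqP ->; apply/negbTE.
have triv (T : finType) col (c : {set T} -> bool) Y : monochromatic r.+1 0 col c Y.
  exists set0; rewrite sub0set cards0; split=> // B; rewrite subset0 => /eqP ->.
  by rewrite cards0.
elim: {a b}(a + b)%N {-2}a {-2}b (erefl (a + b)%N) => [|k IHk] [|a] [|b] E;
  try by exists 0%N => T c Y _; auto.
have [Ma HMa] := IHk a b.+1 ltac:(lia).
have [Mb HMb] := IHk a.+1 b ltac:(lia).
have [M HM] := IHr Ma Mb.
exists M.+1 => T c Y MY.
have /card_gt0P[x xY] : (0 < #|Y|)%N by apply: leq_trans MY.
have MY' : (M <= #|Y :\ x|)%N by move: MY; rewrite (cardsD1 x Y) xY.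
have xZ (Z : {set T}) : Z \subset Y :\ x -> x \notin Z.
  by move=> ZY; apply/negP => /(subsetP ZY); rewrite !inE eqxx.
have xZY (Z : {set T}) : Z \subset Y :\ x -> x |: Z \subset Y.
  by move=> ZY; rewrite subUset sub1set xY (subset_trans ZY) // subD1set.
have [[Z [ZY Zc Zx]]|[Z [ZY Zc Zx]]] := HM T (fun B => c (x |: B)) _ MY'.
- have [m|m] := HMa T c Z ltac:(by rewrite Zc).
  + by left; apply: monochromatic_sub (xZY _ ZY) _; apply: monochromaticU1 => //; apply: xZ.
  + right; apply: monochromatic_sub m; exact: subset_trans ZY (subD1set _ _).
- have [m|m] := HMb T c Z ltac:(by rewrite Zc).
  + left; apply: monochromatic_sub m; exact: subset_trans ZY (subD1set _ _).
  + by right; apply: monochromatic_sub (xZY _ ZY) _; apply: monochromaticU1 => //; apply: xZ.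
Qed.

Definition copies (W V : finType) (F : {set {set W}}) (G : {set {set V}}) :
    {set {ffun W -> V}} :=
  [set f : {ffun W -> V} | injectiveb f & [forall A in F, f @: A \in G]].

(** When [G] consists of the blue [r]-sets of a colouring of a primal graph, an edge of the
    hypergraph in [clean r s G] spans a red complete graph. *)
Definition clean (r s : nat) (V : finType) (G : {set {set V}}) : {set {set V}} :=
  [set A : {set V} | (#|A| == s) &
    [forall B : {set V}, (B \subset A) && (#|B| == r) ==> (B \notin G)]].

Lemma card_le_fibers (I J : finType) (A : {set I}) (B : {set J})
    (Q : J -> I -> bool) (k : nat) :
  (forall i, i \in A -> exists2 j, j \in B & Q j i) ->
  (forall j, j \in B -> (#|[set i | Q j i]| <= k)%N) -> (#|A| <= #|B| * k)%N.
Proof.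
move=> cov fib; rewrite -sum1_card.
apply: (@leq_trans (\sum_(i in A) \sum_(j in B | Q j i) 1)%N).
  by apply: leq_sum => i /cov[j jB Qji]; rewrite (bigD1 j) ?jB.
rewrite (exchange_big_dep (mem B)) /=; last by move=> i j _ /andP[].
rewrite -sum_nat_const; apply: leq_sum => j jB; apply: leq_trans (fib j jB).
rewrite sum1dep_card; apply: subset_leq_card; apply/subsetP => i.
by rewrite !inE => /and3P[].
Qed.

Lemma card_family_le (W V : finType) (D : {set W}) (Q : W -> pred V) (k : nat) :
  (forall x, x \in D -> (#|Q x| <= k)%N) ->
  (#|family Q| <= k ^ #|D| * #|V| ^ (#|W| - #|D|))%N.
Proof.
move=> Qk; rewrite card_family foldrE big_image /=.
rewrite (bigID (mem D)) /= leq_mul //.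
  by rewrite -prod_nat_const; apply: leq_prod.
have -> : (#|W| - #|D| = #|~: D|)%N by rewrite -(cardsC D) addKn.
rewrite -prod_nat_const (eq_bigl (mem (~: D))) => [|i]; last by rewrite !inE.
by apply: leq_prod => i _; apply: max_card.
Qed.

(** A map [g] with prescribed composite [g \o a] is determined on the range of [a]; its other
    [#|B| - #|A|] values are free. *)
Lemma card_comp_le (A B V : finType) (a : A -> B) (P : {set {ffun A -> V}}) :
  injective a ->
  (#|[set g : {ffun B -> V} | [ffun i => g (a i)] \in P]|
     <= #|P| * #|V| ^ (#|B| - #|A|))%N.
Proof.
move=> ainj; apply: (card_le_fibers (Q := fun (b : {ffun A -> V}) (g : {ffun B -> V}) => [ffun i => g (a i)] == b)).
  by move=> g; rewrite inE => gP; exists [ffun i => g (a i)].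
move=> b _; pose Q y := [pred x | [forall i, (a i == y) ==> (x == b i)]].
rewrite -(card_imset predT ainj) -[leqRHS]mul1n -(exp1n #|a @: predT|).
apply: leq_trans (card_family_le (Q := Q) _).
  apply: subset_leq_card; apply/subsetP => g; rewrite inE => /eqP gb.
  apply/familyP => y; rewrite !inE; apply/forallP => i; apply/implyP => /eqP <-.
  by rewrite -gb ffunE.
move=> y /imsetP[i _ ->]; rewrite -(card1 (b i)); apply: subset_leq_card.
by apply/subsetP => x; rewrite !inE => /forallP/(_ i); rewrite eqxx.
Qed.

(** Each of the [M] factors [n - i] of the falling factorial is at least [n / 2]. *)
Lemma expn_le_ffact (n M : nat) : (2 * M <= n)%N -> (n ^ M <= 2 ^ M * n ^_ M)%N.
Proof.
move=> Mn; rewrite ffact_prod -[X in (2 ^ X)%N]card_ord -[X in (n ^ X)%N]card_ord.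
by rewrite -!prod_nat_const -big_split /=; apply: leq_prod => i _; have := ltn_ord i; lia.
Qed.

(** Averaging over the injections [g] of ['I_M] into ['I_n]. Colour an [r]-subset of ['I_M] by
    whether its image lies outside [G]: Ramsey's theorem finds an [s]-subset with clean image or a
    copy of [F] inside the image of [g]. One of the two outcomes accounts for at least half of all
    injections, and a given clean set or copy arises from few of them. *)
Lemma supersaturation (r s : nat) (W : finType) (F : {set {set W}}) :
  (forall A, A \in F -> #|A| = r) ->
  exists K n0 : nat, forall n (G : {set {set 'I_n}}), (n0 <= n)%N ->
  (n ^ s <= K * #|clean r s G|)%N \/ (n ^ #|W| <= K * #|copies F G|)%N.
Proof.
move=> Fr; have [M0 ram] := ramsey r s #|W|.
pose M := maxn M0 (maxn s #|W|).
have sM : (s <= M)%N by rewrite !leq_max leqnn orbT.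
have WM : (#|W| <= M)%N by rewrite !leq_max leqnn !orbT.
(* [M ^ s] and [M ^ #|W|] bound the positions inside ['I_M], and [s ^ s] the maps onto a given
   [s]-set. The remaining factors of the final constant are [2 ^ M] from [expn_le_ffact] and 2 for
   keeping the larger of two terms. *)
pose K1 := (M ^ s * s ^ s)%N; pose K2 := (M ^ #|W|)%N.
exists (2 ^ M * (2 * (K1 + K2)))%N, (2 * M).+1 => n G n0.
have npos : (0 < n)%N by lia.
pose I := [set g : {ffun 'I_M -> 'I_n} | injectiveb g].
pose clinj := [set b : {ffun 'I_s -> 'I_n} | b @: setT \in clean r s G].
pose I1 := [set g in I | [exists a : {ffun 'I_s -> 'I_M},
   injectiveb a && ([ffun i => g (a i)] \in clinj)]].
pose I2 := [set g in I | [exists a : {ffun W -> 'I_M},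
   injectiveb a && ([ffun i => g (a i)] \in copies F G)]].
have cI : #|I| = n ^_ M by rewrite card_inj_ffuns !card_ord.
have I12 : I \subset I1 :|: I2.
  apply/subsetP => g gI; rewrite in_setU ![g \in [set _ in I | _]]inE gI /=.
  have ginj : injective g by apply/injectiveP; move: gI; rewrite inE.
  have [|[X [_ Xs Xc]]|[X [_ Xs Xc]]] := ram _ (fun B => g @: B \notin G) [set: 'I_M].
  - by rewrite cardsT card_ord leq_max leqnn.
  - apply/orP; left; apply/existsP.
    exists [ffun i => enum_val (cast_ord (esym Xs) i)]; apply/andP; split.
      by apply/injectiveP => i j; rewrite !ffunE => /enum_val_inj /cast_ord_inj.
    set b := finfun _; rewrite inE; have -> : b @: setT = g @: X.
      apply/setP => y; apply/imsetP/imsetP => [[i _ ->]|[x xX ->]].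
        by rewrite !ffunE; exists (enum_val (cast_ord (esym Xs) i)); rewrite ?enum_valP.
      exists (cast_ord Xs (enum_rank_in xX x)) => //.
      by rewrite !ffunE cast_ordK enum_rankK_in.
    rewrite inE card_imset // Xs eqxx /=; apply/forallP => B; apply/implyP => /andP[BX /eqP Br].
    have gB : g @: (g @^-1: B) = B.
      apply/setP => y; apply/imsetP/idP => [[x + ->]|yB]; first by rewrite inE.
      by have /imsetP[x _ yx] := subsetP BX y yB; exists x; rewrite // inE -yx.
    have := Xc (g @^-1: B); rewrite gB; apply; last by rewrite -(card_imset _ ginj) gB.
    by apply/subsetP => x; rewrite inE => /(subsetP BX) /imsetP[x' x'X /ginj ->].
  apply/orP; right; apply/existsP.
  pose a w := enum_val (cast_ord (esym Xs) (enum_rank w)).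
  have ainj : injective a by move=> i j /enum_val_inj /cast_ord_inj /enum_rank_inj.
  exists (finfun a); apply/andP; split.
    by apply/injectiveP => i j; rewrite !ffunE => /ainj.
  rewrite inE; apply/andP; split.
    by apply/injectiveP => i j; rewrite !ffunE => /ginj /ainj.
  apply/forallP => A; apply/implyP => AF.
  rewrite (eq_imset _ (_ : _ =1 g \o a)) => [|x]; last by rewrite !ffunE.
  rewrite imset_comp; apply: negbFE; apply: (Xc (a @: A)).
    by apply/subsetP => x /imsetP[w _ ->]; apply: enum_valP.
  by rewrite card_imset // Fr.
have c1 : (#|I1| <= K1 * #|clean r s G| * n ^ (M - s))%N.
  apply: leq_trans (card_le_fibers (B := [set a : {ffun 'I_s -> 'I_M} | injectiveb a])
    (Q := fun a (g : {ffun 'I_M -> 'I_n}) => [ffun i => g (a i)] \in clinj)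
    (k := #|clinj| * n ^ (M - s)) _ _) _.
  - move=> g; rewrite inE => /andP[_ /existsP[a /andP[ai ac]]].
    by exists a => //; rewrite inE.
  - move=> a; rewrite inE => /injectiveP ai.
    by have := card_comp_le clinj ai; rewrite !card_ord.
  have cc : (#|clinj| <= #|clean r s G| * s ^ s)%N.
    apply: (card_le_fibers (Q := fun (A : {set 'I_n}) (b : {ffun 'I_s -> 'I_n}) => b @: setT == A)).
      by move=> b; rewrite inE => bc; exists (b @: setT).
    move=> A; rewrite inE => /andP[/eqP As _]; have : (#|ffun_on (mem A) : pred {ffun 'I_s -> 'I_n}| <= s ^ s)%N.
      by rewrite card_ffun_on As card_ord.
    apply: leq_trans; apply: subset_leq_card; apply/subsetP => b; rewrite inE => /eqP bA.
    by apply/ffun_onP => i; rewrite -bA imset_f.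
  have ca : (#|[set a : {ffun 'I_s -> 'I_M} | injectiveb a]| <= M ^ s)%N.
    by apply: leq_trans (max_card _) _; rewrite card_ffun !card_ord.
  rewrite /K1 -mulnA [X in (_ <= X)%N]mulnA -!mulnA leq_mul // mulnA leq_mul //.
  by rewrite mulnC.
have c2 : (#|I2| <= K2 * #|copies F G| * n ^ (M - #|W|))%N.
  apply: leq_trans (card_le_fibers (B := [set a : {ffun W -> 'I_M} | injectiveb a])
    (Q := fun a (g : {ffun 'I_M -> 'I_n}) => [ffun i => g (a i)] \in copies F G)
    (k := #|copies F G| * n ^ (M - #|W|)) _ _) _.
  - move=> g; rewrite inE => /andP[_ /existsP[a /andP[ai ac]]].
    by exists a => //; rewrite inE.
  - move=> a; rewrite inE => /injectiveP ai.
    by have := card_comp_le (copies F G) ai; rewrite !card_ord.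
  rewrite -mulnA leq_mul //.
  by apply: leq_trans (max_card _) _; rewrite card_ffun !card_ord.
have : (n ^ M <= 2 ^ M * (K1 * #|clean r s G| * n ^ (M - s) + K2 * #|copies F G| * n ^ (M - #|W|)))%N.
  apply: leq_trans (expn_le_ffact _) _; first by lia.
  rewrite leq_mul // -cI; apply: leq_trans (subset_leq_card I12) _.
  by apply: leq_trans (leq_card_setU _ _) _; apply: leq_add.
set x := (K1 * _ * _)%N; set y := (K2 * _ * _)%N => bound.
have split_pow k : (k <= M)%N -> (n ^ M = n ^ k * n ^ (M - k))%N.
  by move=> kM; rewrite -expnD subnKC.
have [xy|yx] := leqP y x; [left|right].
  rewrite -(@leq_pmul2r (n ^ (M - s))) ?expn_gt0 ?npos // -split_pow //.
  apply: leq_trans bound _; rewrite -!mulnA leq_mul //.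
  apply: leq_trans (_ : 2 * x <= _)%N; first by lia.
  by rewrite /x -mulnA mulnDl leq_mul2l leq_addr orbT.
rewrite -(@leq_pmul2r (n ^ (M - #|W|))) ?expn_gt0 ?npos // -split_pow //.
apply: leq_trans bound _; rewrite -!mulnA leq_mul //.
apply: leq_trans (_ : 2 * y <= _)%N; first by lia.
by rewrite /y -mulnA mulnDl leq_mul2l leq_addl orbT.
Qed.

(** * Hypergraph containers *)

(** The codegree of [T]. In particular [wdeg w set0] is the total weight, and is used as such
    below. *)
Definition wdeg (R : realFieldType) (V : finType) (w : {set V} -> R)
  (T : {set V}) : R := \sum_(e : {set V} | T \subset e) w e.

Definition wmass (R : realFieldType) (V : finType) (w : {set V} -> R)
  (C : {set V}) : R := \sum_(e : {set V} | e \subset C) w e.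

(* The degree bound is [wdeg w T <= D * tau ^+ (#|T| - 1)], multiplied by [tau]
   to avoid the subtraction. *)
Definition spread (R : realFieldType) (V : finType) (s : nat) (D tau : R)
    (w : {set V} -> R) : Prop :=
  [/\ forall e, 0 <= w e,
      forall e, w e != 0 -> #|e| = s
    & forall T : {set V}, T != set0 -> tau * wdeg w T <= D * tau ^+ #|T|].

(** Only an inequality is required, so that parts of the links of the vertices of [S] can be left
    out to keep the degrees of [w'] bounded. *)
Definition in_link (R : realFieldType) (V : finType) (w : {set V} -> R)
    (S : {set V}) (w' : {set V} -> R) : Prop :=
  forall e, w' e <= \sum_(v in S | v \notin e) w (v |: e).

(** The threshold is half of the bound [2 * D * tau ^+ #|T|] that [spread s (2 * tau * D) tau w']
    places on the degree of [T]. *)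
Definition unsaturated (R : realFieldType) (V : finType) (D tau : R)
    (w' : {set V} -> R) (e : {set V}) : bool :=
  [forall T : {set V}, (T != set0) && (T \subset e) ==>
     (wdeg w' T < D * tau ^+ #|T|)].

Definition free_link (R : realFieldType) (V : finType) (D tau : R)
    (w w' : {set V} -> R) (v : V) (e : {set V}) : R :=
  if (v \notin e) && unsaturated D tau w' e then w (v |: e) else 0.

Lemma sum_setU1 (R : realFieldType) (V : finType) (v : V)
    (P : pred {set V}) (F : {set V} -> R) :
  \sum_(e : {set V} | (v \notin e) && P e) F (v |: e) =
  \sum_(e : {set V} | (v \in e) && P (e :\ v)) F e.
Proof.
rewrite [RHS](reindex_onto (fun e => v |: e) (fun e => e :\ v)) /=; last first.
  by move=> e /andP[ve _]; rewrite setD1K.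
apply: eq_bigl => e; rewrite setU11 /=.
have [ve|ve] /= := boolP (v \in e).
  apply/esym/negbTE/negP => /andP[_ /eqP E].
  by move: ve; rewrite -E !inE eqxx.
by rewrite setU1K // eqxx andbT.
Qed.

Lemma wdegD (R : realFieldType) (V : finType) (w1 w2 : {set V} -> R) T :
  wdeg (fun e => w1 e + w2 e) T = wdeg w1 T + wdeg w2 T.
Proof. exact: big_split. Qed.

Lemma wdeg_ge0 (R : realFieldType) (V : finType) (w : {set V} -> R) T :
  (forall e, 0 <= w e) -> 0 <= wdeg w T.
Proof. by move=> w0; apply: sumr_ge0. Qed.

Lemma wdeg_free_link (R : realFieldType) (V : finType) (D tau : R)
    (w w' : {set V} -> R) (v : V) (T : {set V}) :
  (forall e, 0 <= w e) -> v \notin T ->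
  wdeg (free_link D tau w w' v) T <= wdeg w (v |: T).
Proof.
move=> w0 vT.
apply: (@le_trans _ _ (\sum_(e : {set V} | (v \notin e) && (T \subset e)) w (v |: e))).
  rewrite {1}/wdeg (bigID (fun e : {set V} => v \notin e)) /= [X in _ + X]big1 ?addr0; last first.
    by move=> e /andP[_ /negbTE ve]; rewrite /free_link ve.
  under eq_bigl => e do rewrite andbC.
  apply: ler_sum => e _; rewrite /free_link; case: ifP => // _; exact: w0.
rewrite (sum_setU1 _ (fun e => T \subset e)) /wdeg; rewrite le_eqVlt; apply/predU1P; left; apply: eq_bigl => e.
by rewrite subsetD1 vT andbT subUset sub1set.
Qed.

Lemma wdeg_free_link0 (R : realFieldType) (V : finType) (D tau : R)
    (w w' : {set V} -> R) (v : V) :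
  wdeg (free_link D tau w w' v) set0 =
  \sum_(e : {set V} | (v \in e) && unsaturated D tau w' (e :\ v)) w e.
Proof.
rewrite -(sum_setU1 _ (unsaturated D tau w')) /wdeg.
under eq_bigl => e do rewrite sub0set.
by rewrite -big_mkcond.
Qed.

(* A set [T] that is not saturated has spare degree [D tau^|T|],
   which is all that the link of a single vertex can contribute. *)
Lemma link_extend (R : realFieldType) (V : finType) (s : nat) (D tau : R)
    (w w' : {set V} -> R) (S : {set V}) (v : V) :
  0 < tau -> 0 < D -> spread s.+1 D tau w ->
  spread s (2 * tau * D) tau w' -> in_link w S w' -> v \notin S ->
  let w2 := fun e => w' e + free_link D tau w w' v e in
  spread s (2 * tau * D) tau w2 /\ in_link w (v |: S) w2.
Proof.
move=> tau0 D0 [w0 wsz wdg] [w'0 w'sz w'dg] w'l vS w2.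
have fl0 e : 0 <= free_link D tau w w' v e.
  by rewrite /free_link; case: ifP.
split; last first.
  move=> e; rewrite /w2 big_mkcondr big_setU1 //= addrC.
  have l2 := w'l e; rewrite big_mkcondr in l2.
  have l1 : free_link D tau w w' v e <= if v \notin e then w (v |: e) else 0.
    by rewrite /free_link; case: ifP => [/andP[-> //]|_]; case: ifP.
  exact: lerD l2 l1.
split=> [e|e|T T0].
- by rewrite addr_ge0.
- rewrite /w2; have [->|/w'sz //] := eqVneq (w' e) 0.
  rewrite add0r /free_link; case: ifP => [/andP[ve _] /wsz|]; last by rewrite eqxx.
  by rewrite cardsU1 ve => -[].
have {}w'dg := w'dg T T0.
rewrite /w2 wdegD.
have [sat|unsat] := leP (D * tau ^+ #|T|) (wdeg w' T).
  suff -> : wdeg (free_link D tau w w' v) T = 0 by rewrite addr0.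
  rewrite /wdeg big1 // => e Te; rewrite /free_link; case: ifP => // /andP[_].
  by move/forallP/(_ T); rewrite T0 Te /= ltNge sat.
rewrite (_ : _ * _ * _ * _ = tau * (D * tau ^+ #|T| + D * tau ^+ #|T|)); last by ring.
rewrite ler_pM2l // lerD //; first exact: ltW.
have [vT|vT] := boolP (v \in T).
  rewrite /wdeg big1 ?mulr_ge0 ?exprn_ge0 ?ltW // => e Te.
  by rewrite /free_link (subsetP Te _ vT).
apply: le_trans (wdeg_free_link _ _ _ w0 vT) _.
rewrite -(ler_pM2l tau0); apply: le_trans (wdg (v |: T) _) _.
  by apply/set0Pn; exists v; rewrite setU11.
by rewrite cardsU1 vT exprS mulrCA.
Qed.

(** An edge of positive weight is counted once for each of its [2 ^ s] subsets. *)
Lemma sum_wdeg (R : realFieldType) (V : finType) (s : nat) (w : {set V} -> R) :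
  (forall e, w e != 0 -> #|e| = s) ->
  \sum_(T : {set V}) wdeg w T = 2 ^+ s * wdeg w set0.
Proof.
move=> wsz; rewrite /wdeg (exchange_big_dep predT) //= mulr_sumr.
under [RHS]eq_bigl => e do rewrite sub0set.
apply: eq_bigr => e _; have [->|/wsz <-] := eqVneq (w e) 0.
  by rewrite mulr0 big1.
rewrite sumr_const -natrX mulr_natl -card_powerset; congr (_ *+ _).
by apply: eq_card => T; rewrite powersetE.
Qed.

(** An edge of positive weight inside [C] meets [S], or has a vertex [v] outside [S] for which
    [e :\ v] is unsaturated, or contains a saturated set. The three terms of the bound correspond to
    these cases: vertices of [S] have degree at most [D], other vertices of [C] carry free links of
    mass at most [lam], and saturated sets are few because [w'] has bounded total mass. *)
Lemma wmass_container (R : realFieldType) (V : finType) (s : nat)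
    (D tau lam N : R) (w w' : {set V} -> R) (S C U : {set V}) :
  0 < tau -> 0 < D -> 0 <= lam -> #|U|%:R <= N ->
  spread s.+1 D tau w -> (forall e, w e != 0 -> e \subset U) ->
  spread s (2 * tau * D) tau w' ->
  (forall v, v \in C -> v \notin S -> wdeg (free_link D tau w w' v) set0 <= lam) ->
  wmass w C <= D * #|S|%:R + lam * N + 2 ^+ s * wdeg w' set0 / tau.
Proof.
move=> tau0 D0 lam0 UN [w0 wsz wdg] wU [w'0 w'sz w'dg] small.
pose ok (v : V) (e : {set V}) := (v \in e) && unsaturated D tau w' (e :\ v).
pose sat (T : {set V}) := (T != set0) && (D * tau ^+ #|T| <= wdeg w' T).
apply: (@le_trans _ _ (\sum_(e : {set V}) (\sum_(v in S | v \in e) w e +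
   \sum_(v in (C :\: S) :&: U | ok v e) w e + \sum_(T | sat T && (T \subset e)) w e))).
  rewrite /wmass big_mkcond; apply: ler_sum => e _; case: ifP => [eC|_]; last first.
    by rewrite !addr_ge0 // sumr_ge0.
  have [->|we] := eqVneq (w e) 0; first by rewrite !addr_ge0 // sumr_ge0.
  have A1 : 0 <= \sum_(v in S | v \in e) w e by rewrite sumr_ge0.
  have A2 : 0 <= \sum_(v in (C :\: S) :&: U | ok v e) w e by rewrite sumr_ge0.
  have A3 : 0 <= \sum_(T | sat T && (T \subset e)) w e by rewrite sumr_ge0.
  have le1 (I : finType) (P : pred I) i : P i -> w e <= \sum_(i | P i) w e.
    by move=> Pi; rewrite (bigD1 i) //= lerDl sumr_ge0.
  have /card_gt0P[v ve] : (0 < #|e|)%N by rewrite (wsz _ we).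
  have vC := subsetP eC _ ve; have vU := subsetP (wU _ we) _ ve.
  have [vS|vS] := boolP (v \in S).
    by rewrite -addrA ler_wpDr ?addr_ge0 // (le1 _ _ v) // vS.
  have [us|] := boolP (unsaturated D tau w' (e :\ v)).
    rewrite ler_wpDr // ler_wpDl //; apply: (le1 _ _ v).
    by rewrite /ok !inE vS vC vU ve us.
  rewrite negb_forall => /existsP[T]; rewrite negb_imply -leNgt => /andP[/andP[T0 Te] sT].
  rewrite ler_wpDl ?addr_ge0 //; apply: (le1 _ _ T).
  by rewrite /sat T0 sT (subset_trans Te) // subD1set.
rewrite !big_split /=; apply: lerD; first apply: lerD.
- rewrite (exchange_big_dep (mem S)) //=; last by move=> e v _ /andP[].
  rewrite mulr_natr -sumr_const; apply: ler_sum => v vS.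
  rewrite -(ler_pM2l tau0) [leRHS]mulrC -[X in D * X]expr1 -(cards1 v).
  apply: le_trans (wdg [set v] _); last by apply/set0Pn; exists v; rewrite inE.
  rewrite ler_pM2l // /wdeg; rewrite le_eqVlt; apply/predU1P; left; apply: eq_bigl => e.
  by rewrite vS sub1set.
- rewrite (exchange_big_dep (mem ((C :\: S) :&: U))) //=; last by move=> e v _ /andP[].
  apply: (@le_trans _ _ (\sum_(v in (C :\: S) :&: U) lam)).
    apply: ler_sum => v; rewrite !inE => /andP[/andP[vS vC] vU].
    under eq_bigl => e do rewrite vS vC vU /=.
    by rewrite -(wdeg_free_link0 D tau w w' v) small.
  rewrite sumr_const -mulr_natr ler_wpM2l //; apply: le_trans UN.
  by rewrite ler_nat subset_leq_card // subsetIr.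
(* For saturated [T], [tau * wdeg w T <= D * tau ^+ #|T| <= wdeg w' T]; summing over [T] with
   [sum_wdeg] produces the factor [2 ^+ s]. *)
rewrite (exchange_big_dep sat) //=; last by move=> e v _ /andP[].
rewrite -(sum_wdeg w'sz) mulr_suml [leRHS](bigID sat) /= ler_wpDr //.
  by rewrite sumr_ge0 // => T _; rewrite mulr_ge0 ?wdeg_ge0 // invr_ge0 ltW.
apply: ler_sum => T sT; under eq_bigl => e do rewrite sT /=.
case/andP: sT => T0 sT.
rewrite ler_pdivlMr // mulrC; apply: le_trans sT; exact: wdg.
Qed.
Lemma spread_deg1 (R : realFieldType) (V : finType) (s : nat) (D tau : R)
    (w : {set V} -> R) (v : V) :
  0 < tau -> spread s D tau w -> wdeg w [set v] <= D.
Proof.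
move=> tau0 [_ _ wdg]; rewrite -(ler_pM2l tau0) [leRHS]mulrC.
by rewrite -[X in D * X]expr1 -(cards1 v) wdg // -card_gt0 cards1.
Qed.

Lemma wdeg_sum_vertices (R : realFieldType) (V : finType) (A : {set V})
    (w : {set V} -> R) :
  \sum_(e : {set V}) \sum_(v in A | v \in e) w e = \sum_(v in A) wdeg w [set v].
Proof.
rewrite (exchange_big_dep (mem A)) //=; last by move=> e v _ /andP[].
apply: eq_bigr => v vA; rewrite /wdeg; apply: eq_bigl => e.
by rewrite vA sub1set.
Qed.

(** An edge that is not inside [C] uses a vertex of [U :\: C], and every vertex has degree at most
    [D]. *)
Lemma wdeg0_le (R : realFieldType) (V : finType) (s : nat) (D tau : R)
    (w : {set V} -> R) (U C : {set V}) :
  0 < tau -> spread s D tau w -> (forall e : {set V}, w e != 0 -> e \subset U) ->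
  wdeg w set0 <= wmass w C + D * #|U :\: C|%:R.
Proof.
move=> tau0 sp wU; have [w0 _ _] := sp.
have H : \sum_(e : {set V} | ~~ (e \subset C)) w e <=
    \sum_(e : {set V}) \sum_(v in U :\: C | v \in e) w e.
  rewrite big_mkcond; apply: ler_sum => e _.
  case: ifP => [/subsetPn[v ve vC]|_]; last by rewrite sumr_ge0.
  have [->|we] := eqVneq (w e) 0; first by rewrite sumr_ge0.
  rewrite (bigD1 v) /=; first by rewrite lerDl sumr_ge0.
  by rewrite inE vC ve (subsetP (wU _ we) _ ve).
rewrite {1}/wdeg (bigID (fun e : {set V} => e \subset C)) /=.
under eq_bigl => e do rewrite sub0set.
under [X in _ + X]eq_bigl => e do rewrite sub0set.
rewrite lerD2l; apply: le_trans H _; rewrite wdeg_sum_vertices mulr_natr -sumr_const.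
by apply: ler_sum => v _; exact: spread_deg1 sp.
Qed.

Definition independent (R : realFieldType) (V : finType) (w : {set V} -> R)
  (I : {set V}) : Prop := forall e : {set V}, e \subset I -> w e = 0.

(** A list rather than one set: each level of the recursion contributes an entry. The length is
    exactly [q], shorter fingerprints being padded with empty sets. *)
Definition fingerprint (R : realFieldType) (V : finType) (q : nat) (b : R)
    (I : {set V}) (S : seq {set V}) : Prop :=
  size S = q /\ {in S, forall X : {set V}, X \subset I /\ #|X|%:R <= b}.

Lemma in_link_independent (R : realFieldType) (V : finType)
    (w w' : {set V} -> R) (S I : {set V}) :
  (forall e, 0 <= w' e) -> in_link w S w' -> S \subset I ->
  independent w I -> independent w' I.
Proof.
move=> w'0 w'l SI wI e eI; apply/eqP; rewrite eq_le w'0 andbT.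
apply: le_trans (w'l e) _; rewrite big1 // => v /andP[vS _]; apply: wI.
by rewrite subUset sub1set (subsetP SI _ vS).
Qed.

Lemma in_link_support (R : realFieldType) (V : finType)
    (w w' : {set V} -> R) (S U : {set V}) :
  (forall e, 0 <= w' e) -> in_link w S w' ->
  (forall e : {set V}, w e != 0 -> e \subset U) -> forall e : {set V}, w' e != 0 -> e \subset U.
Proof.
move=> w'0 w'l wU e we'.
have : 0 < \sum_(v in S | v \notin e) w (v |: e).
  by apply: lt_le_trans (w'l e); rewrite lt0r we' w'0.
case: (pickP (fun v => (v \in S) && (v \notin e) && (w (v |: e) != 0))) => [v|nov].
  by move=> /andP[_ /wU]; rewrite subUset => /andP[].
rewrite big1 ?ltxx // => v Sv; apply/eqP.
by move: (nov v); rewrite Sv /= => /negbFE.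
Qed.

(** Induction on [s]. The weights [W], the test [dense] and the recursive containers [G] are all
    chosen for every set [S] before [I] is introduced, so [Cont] depends on the fingerprint alone;
    [I] only decides which maximal [S] is recorded. *)
Lemma container_shrink (R : realFieldType) (s : nat) (c : R) : 0 < c ->
  exists delta K tau0 : R, [/\ 0 < delta, 0 < K, 0 < tau0 &
    forall (V : finType) (w : {set V} -> R) (U : {set V}) (N tau D : R),
      0 < tau -> tau <= tau0 -> 0 < D -> #|U|%:R <= N ->
      spread s.+1 D tau w -> (forall e : {set V}, w e != 0 -> e \subset U) ->
      c * D * N <= wdeg w set0 ->
    exists Cont : seq {set V} -> {set V}, forall I, independent w I ->
    exists S, [/\ fingerprint s (K * tau * N) I S, I \subset Cont S
      & delta * N <= #|U :\: Cont S|%:R]].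
Proof.
elim: s c => [|s IHs] c c0.
  exists c, 1, 1; split=> // V w U N tau D tau0 _ D0 UN sp wU wc.
  exists (fun=> [set v | w [set v] == 0]) => I wI; exists [::]; split=> //.
    by apply/subsetP => v vI; rewrite inE wI // sub1set.
  rewrite -(ler_pM2l D0) mulrA [D * c]mulrC.
  apply: le_trans wc _.
  apply: le_trans (wdeg0_le [set v | w [set v] == 0] tau0 sp wU) _.
  rewrite gerDr /wmass big1 // => e eC; apply/eqP; apply: contraT => we.
  have [_ wsz _] := sp; have /eqP/cards1P[v ev] := wsz _ we.
  by move: eC we; rewrite ev sub1set inE => ->.
(* The three error terms of [wmass_container] are each at most [c D N / 8]. *)
pose c' := c / (8 * 2 ^+ s.+2).
have c'0 : 0 < c' by rewrite divr_gt0 // mulr_gt0 // exprn_gt0.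
have [delta' [K' [tau0' [d'0 K'0 t'0 IH]]]] := IHs c' c'0.
pose b := c / 8; have b0 : 0 < b by rewrite divr_gt0.
(* The bound [b ^+ 2 / 2] on [tau] turns [#|S| <= 2 / b * tau * N] into [#|S| <= b * N]. Three
   errors of size [c / 8] leave [5 c / 8], which is more than the claimed [c / 2]. *)
exists (Num.min (c / 2) delta'), (Num.max K' (2 / b)), (Num.min tau0' (b ^+ 2 / 2)).
split; [by rewrite lt_min d'0 divr_gt0|by rewrite lt_max K'0|
        by rewrite lt_min t'0 divr_gt0 // exprn_gt0|].
move=> V w U N tau D tau0; rewrite le_min => /andP[tau1 tau2] D0 UN sp wU wc.
have N0 : 0 <= N by apply: le_trans UN.
pose D' := 2 * tau * D; have D'0 : 0 < D' by rewrite !mulr_gt0.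
pose lam := b * D; have lam0 : 0 < lam by rewrite mulr_gt0.
pose ext S w' := [/\ spread s.+1 D' tau w', in_link w S w'
                   & lam * #|S|%:R <= wdeg w' set0].
have /choice[W WP] (S : {set V}) : exists x, (exists w', ext S w') -> ext S x.
  have [[w' e]|ne] := pselect (exists w', ext S w'); first by exists w'.
  by exists (fun=> 0).
pose dense S := c' * D' * N <= wdeg (W S) set0.
have /choice[G GP] (S : {set V}) : exists g : seq {set V} -> {set V},
    (exists w', ext S w') -> dense S ->
    forall I, independent (W S) I -> exists L,
      [/\ fingerprint s (K' * tau * N) I L, I \subset g L
        & delta' * N <= #|U :\: g L|%:R].
  have [e|ne] := pselect (exists w', ext S w'); last by exists (fun=> set0).
  have [dn|nd] := pselect (dense S); last by exists (fun=> set0) => _ /nd.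
  have [sp' wl' _] := WP _ e; have [w'0 _ _] := sp'.
  have [//|g gP] := IH V (W S) U N tau D' tau0 tau1 D'0 UN sp' (in_link_support w'0 wl' wU).
  by exists g.
(* Vertices outside [S] whose addition keeps [S] admissible are thrown away. By maximality of [S]
   none of them belongs to [I]. *)
pose closure S := S :|: [set v | `[< ~ exists w', ext (v |: S) w' >]].
exists (fun L => if L is X :: L' then if `[< dense X >] then G X L' else closure X else set0).
move=> I wI.
pose P (S : {set V}) := (S \subset I) && `[< exists w', ext S w' >].
have P0 : P set0.
  rewrite /P sub0set; apply/asboolP; exists (fun=> 0); split.
  - split=> // [e|T _]; first by rewrite eqxx.
    by rewrite /wdeg big1 // mulr0 mulr_ge0 ?exprn_ge0 ?ltW.
  - by move=> e; rewrite sumr_ge0 // => v _; have [] := sp.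
  - by rewrite cards0 mulr0 /wdeg big1.
have [S /maxsetP[/andP[SI /asboolP eS] maxS] _] := maxset_exists P0.
have [sp' wl' ml] := WP _ eS; have [w'0 w'sz _] := sp'.
(* Compare two bounds on the mass of [W S]: at least [lam * #|S|] by admissibility, at most [D' * N]
   because its degrees are at most [D']. *)
have Sb : #|S|%:R <= 2 / b * tau * N.
  have m1 : wdeg (W S) set0 <= D' * N.
    apply: le_trans (wdeg0_le set0 tau0 sp' (in_link_support w'0 wl' wU)) _.
    rewrite setD0 /wmass big1 => [|e]; first by rewrite add0r ler_pM2l.
    rewrite subset0 => /eqP ->; apply/eqP; apply: contraT => /w'sz.
    by rewrite cards0.
  rewrite -(ler_pM2l lam0); apply: le_trans ml (le_trans m1 _).
  rewrite le_eqVlt; apply/predU1P; left; rewrite /D' /lam; field.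
  by rewrite gt_eqF.
have [dn|/asboolPn nd] := boolP `[< dense S >].
  have [L [[Lsz Lin] IL dL]] := GP S eS (asboolW dn) I (in_link_independent w'0 wl' SI wI).
  exists (S :: L); rewrite dn; split=> //; last first.
    by apply: le_trans dL; rewrite ler_wpM2r // ge_min lexx orbT.
  split=> /= [|X]; first by rewrite Lsz.
  rewrite inE => /predU1P[->|/Lin[XI Xb]]; split=> //.
    by apply: le_trans Sb _; rewrite !ler_wpM2r // ?(ltW tau0) // le_max lexx orbT.
  by apply: le_trans Xb _; rewrite !ler_wpM2r // ?(ltW tau0) // le_max lexx.
(* The sparse case needs no further information, so the list is padded to length [s.+1]. *)
exists (S :: nseq s set0); case: ifP => [/asboolP //|_].
have K0 : 0 <= Num.max K' (2 / b) by rewrite le_max (ltW K'0).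
split.
- split=> [|X]; first by rewrite /= size_nseq.
  rewrite inE => /predU1P[->|]; first (split=> //).
    by apply: le_trans Sb _; rewrite !ler_wpM2r // ?(ltW tau0) // le_max lexx orbT.
  by rewrite mem_nseq => /andP[_ /eqP ->]; rewrite sub0set cards0 !mulr_ge0 // ltW.
- apply/subsetP => v vI; rewrite !inE; have [//|vS] := boolP (v \in S).
  apply/asboolP => ev.
  have : P (v |: S) by rewrite /P subUset sub1set vI SI /=; apply/asboolP.
  by move=> /maxS /(_ (subsetUr _ _)) E; move: vS; rewrite -E setU11.
(* A free link heavier than [lam] could be added to [W S] by [link_extend], which would make
   [v |: S] admissible. *)
have small v : v \in closure S -> v \notin S ->
    wdeg (free_link D tau w (W S) v) set0 <= lam.
  rewrite !inE => /orP[->//|/asboolP nv vS]; apply: contrapT => /negP.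
  rewrite -ltNge => big; apply: nv.
  have [sp2 l2] := link_extend tau0 D0 sp sp' wl' vS.
  exists (fun e => W S e + free_link D tau w (W S) v e); split=> //.
  by rewrite cardsU1 vS natrD mulrDr mulr1 addrC wdegD lerD // ltW.
have := wmass_container tau0 D0 (ltW lam0) UN sp wU sp' small.
have := wdeg0_le (closure S) tau0 sp wU.
move: nd => /negP; rewrite -ltNge => nd.
have h1 : D * #|S|%:R <= b * (D * N).
  rewrite mulrCA ler_pM2l //; apply: le_trans Sb _; rewrite ler_wpM2r //.
  rewrite -(ler_pM2r (divr_gt0 b0 (ltr0n R 2))).
  apply: le_trans (_ : tau <= _).
    by rewrite le_eqVlt; apply/predU1P; left; field; rewrite gt_eqF.
  by rewrite mulrA -expr2.
have h2 : 2 ^+ s.+1 * wdeg (W S) set0 / tau <= b * (D * N).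
  rewrite ler_pdivrMr //.
  have -> : b * (D * N) * tau = 2 ^+ s.+1 * (c' * D' * N).
    by rewrite /b /c' /D' [2 ^+ s.+2]exprS; field; rewrite expf_neq0 // pnatr_eq0.
  by rewrite ler_pM2l ?exprn_gt0 // ltW.
move=> m1 m2.
have h3 : D * (Num.min (c / 2) delta' * N) <= c / 2 * (D * N).
  by rewrite mulrCA ler_wpM2r ?mulr_ge0 // ?ge_min ?lexx // ltW.
rewrite -(ler_pM2l D0); apply: le_trans h3 _.
have {}m2 := le_trans m2 (lerD (lerD h1 (lexx _)) h2).
rewrite /lam /b -!mulrA in wc m1 m2 *.
have : 0 <= c * (D * N) by rewrite !mulr_ge0 // ltW.
lra.
Qed.
Definition restrict (R : realFieldType) (V : finType) (w : {set V} -> R)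
  (U e : {set V}) : R := if e \subset U then w e else 0.

Lemma spread_restrict (R : realFieldType) (V : finType) (s : nat) (D tau : R)
    (w : {set V} -> R) (U : {set V}) :
  0 < tau -> spread s D tau w -> spread s D tau (restrict w U).
Proof.
move=> tau0 [w0 wsz wdg]; split=> [e|e|T T0]; rewrite /restrict.
- by case: ifP.
- by case: ifP => [_ /wsz|]; rewrite ?eqxx.
- apply: le_trans (wdg T T0); rewrite ler_pM2l //.
  by apply: ler_sum => e _; case: ifP.
Qed.

Lemma wdeg0_restrict (R : realFieldType) (V : finType) (w : {set V} -> R)
    (U : {set V}) : wdeg (restrict w U) set0 = wmass w U.
Proof.
by rewrite /wdeg /wmass [RHS]big_mkcond; apply: eq_bigl => e; rewrite sub0set.
Qed.

(** Iterate [container_shrink] on the restriction of [w] to the current vertex set [U]. Each round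
    removes at least [delta * N] vertices, so within [k] rounds, [k] being about [1 / delta], the
    weight inside falls below [c * D * N] or [U] is empty. The fingerprints of the rounds are
    concatenated. *)
Lemma containers (R : archiRealFieldType) (s : nat) (c : R) : 0 < c ->
  exists (q : nat) (K tau0 : R), [/\ 0 < K, 0 < tau0 &
    forall (V : finType) (w : {set V} -> R) (U : {set V}) (N tau D : R),
      0 < tau -> tau <= tau0 -> 0 < D -> 0 < N -> #|U|%:R <= N ->
      spread s.+1 D tau w ->
    exists Cont : seq {set V} -> {set V}, forall I, independent w I ->
      I \subset U ->
    exists S, [/\ fingerprint q (K * tau * N) I S, I \subset Cont S
      & wmass w (Cont S) < c * D * N]].
Proof.
move=> c0; have [delta [K [tau0 [d0 K0 t0 step]]]] := container_shrink s c0.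
pose k := Num.bound delta^-1.
have kd : 1 <= k%:R * delta.
  by rewrite -ler_pdivrMr // mul1r ltW // archi_boundP // invr_ge0 ltW.
exists (k * s)%N, K, tau0; split=> // V w U N tau D tau_gt0 tau1 D0 N0 UN sp.
have : #|U|%:R <= k%:R * (delta * N).
  by rewrite mulrA; apply: le_trans UN _; rewrite ler_peMl // ltW.
elim: k U UN {kd} => [|k IHk] U UN Uk.
  exists (fun=> U) => I wI IU; exists [::]; split=> [||] //.
  rewrite /wmass big1 => [|e eU]; first by rewrite !mulr_gt0.
  have [_ wsz _] := sp.
  apply/eqP; apply: contraT => /wsz ez; move: Uk; rewrite mul0r.
  by rewrite lern0 -leqn0 => /(leq_trans (subset_leq_card eU)); rewrite ez.
have b0 : 0 <= K * tau * N by rewrite !mulr_ge0 // ltW.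
have [sparse|dense] := ltP (wmass w U) (c * D * N).
  exists (fun=> U) => I wI IU; exists (nseq (k.+1 * s) set0); split=> //.
  split=> [|X]; first by rewrite size_nseq.
  by rewrite mem_nseq => /andP[_ /eqP ->]; rewrite sub0set cards0.
have sU e : restrict w U e != 0 -> e \subset U.
  by rewrite /restrict; case: ifP => //; rewrite eqxx.
rewrite -wdeg0_restrict in dense.
have [C1 C1P] := step V _ U N tau D tau_gt0 tau1 D0 UN (spread_restrict U tau_gt0 sp) sU dense.
have /choice[C2 C2P] (X : {set V}) : exists C2 : seq {set V} -> {set V},
    delta * N <= #|U :\: X|%:R ->
    forall I, independent w I -> I \subset U :&: X -> exists S,
      [/\ fingerprint (k * s) (K * tau * N) I S, I \subset C2 S
        & wmass w (C2 S) < c * D * N].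
  have [big|small] := leP (delta * N) #|U :\: X|%:R; last by exists (fun=> set0).
  have [||C2 C2P] := IHk (U :&: X); last by exists C2.
  - by apply: le_trans UN; rewrite ler_nat subset_leq_card // subsetIl.
  rewrite -(lerD2r #|U :\: X|%:R) -natrD cardsID; apply: le_trans Uk _.
  by rewrite -[in leLHS]natr1 mulrDl mul1r lerD2l.
exists (fun L => C2 (C1 (take s L)) (drop s L)) => I wI IU.
have wI' : independent (restrict w U) I.
  by move=> e eI; rewrite /restrict wI //; case: ifP.
have [S1 [[sz1 in1] IC1 big]] := C1P I wI'.
have [|S2 [[sz2 in2] IC2 sm]] := C2P _ big I wI; first by rewrite subsetI IU.
exists (S1 ++ S2); rewrite take_size_cat // drop_size_cat //; split=> //.
split=> [|X]; first by rewrite size_cat sz1 sz2.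
by rewrite mem_cat => /orP[/in1|/in2].
Qed.

(** * The hypergraph of copies of a fixed hypergraph *)

Lemma bin_le_exp (n k : nat) : ('C(n, k) <= n ^ k)%N.
Proof.
have : (n ^_ k <= n ^ k)%N.
  rewrite ffact_prod -[X in (_ <= n ^ X)%N]card_ord -prod_nat_const.
  by apply: leq_prod => i _; apply: leq_subr.
by apply: leq_trans; rewrite -bin_ffact leq_pmulr // fact_gt0.
Qed.

(** Encodes the hypergraph whose vertices are the subsets of [V] and whose edges are the edge sets
    of copies of [F]. Weighting by multiplicity makes masses count injections. *)
Definition copy_weight (R : realFieldType) (W V : finType) (F : {set {set W}})
    (e : {set {set V}}) : R :=
  #|[set f : {ffun W -> V} | injectiveb f & [set f @: A | A : {set W} in F] == e]|%:R.

Lemma copy_weight_neq0 (R : realFieldType) (W V : finType) (F : {set {set W}})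
    (e : {set {set V}}) : copy_weight R F e != 0 ->
  exists2 f : {ffun W -> V}, injective f & [set f @: A | A : {set W} in F] = e.
Proof.
rewrite pnatr_eq0 -lt0n => /card_gt0P[f]; rewrite inE => /andP[/injectiveP fi /eqP <-].
by exists f.
Qed.

Lemma sum_copy_weight (R : realFieldType) (W V : finType) (F : {set {set W}})
    (P : pred {set {set V}}) :
  \sum_(e | P e) copy_weight R F e =
  #|[set f : {ffun W -> V} | injectiveb f & P [set f @: A | A : {set W} in F]]|%:R.
Proof.
rewrite -natr_sum -sum1dep_card; congr (_%:R).
rewrite (partition_big (fun f : {ffun W -> V} => [set f @: A | A : {set W} in F]) P) /=; last first.
  by move=> f /andP[].
apply: eq_bigr => e Pe; rewrite -sum1dep_card; apply: eq_bigl => f.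
by case: eqP => [->|]; rewrite ?Pe ?andbT ?andbF.
Qed.

Lemma wmass_copy_weight (R : realFieldType) (W V : finType) (F : {set {set W}})
    (G : {set {set V}}) : wmass (copy_weight R F) G = #|copies F G|%:R.
Proof.
rewrite /wmass sum_copy_weight; congr (_%:R); apply: eq_card => f.
rewrite !inE; congr (_ && _); apply/subsetP/forallP => [H A|H _ /imsetP[A AF ->]].
  by apply/implyP => AF; apply: H; apply: imset_f.
exact: (implyP (H A)).
Qed.

(** Such an [f] maps [cover J] into [cover T], which has at most [#|W|] points as soon as one such
    [f] exists; the vertices outside [cover J] are free. *)
Lemma card_copies_through (W V : finType) (J : {set {set W}}) (T : {set {set V}}) :
  (#|[set f : {ffun W -> V} | [set f @: A | A : {set W} in J] == T]|
     <= #|W| ^ #|W| * #|V| ^ (#|W| - #|cover J|))%N.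
Proof.
set S := [set f | _]; have [->|[f0]] := set_0Vmem S; first by rewrite cards0.
rewrite inE => /eqP f0T; pose Q x : pred V := fun y => (x \in cover J) ==> (y \in cover T).
apply: leq_trans (_ : #|family Q| <= _)%N.
  apply: subset_leq_card; apply/subsetP => f; rewrite inE => /eqP fT.
  apply/familyP => x; apply/implyP => /bigcupP[A AJ xA].
  by apply/bigcupP; exists (f @: A); rewrite ?imset_f // -fT imset_f.
have cT : (#|cover T| <= #|W|)%N.
  have : (#|f0 @: setT| <= #|W|)%N by rewrite -cardsT leq_imset_card.
  apply: leq_trans; apply: subset_leq_card; apply/subsetP => y /bigcupP[B]; rewrite -f0T => /imsetP[A _ ->].
  by move=> /imsetP[x _ ->]; apply: imset_f.
apply: leq_trans (card_family_le (D := cover J) (k := #|W|) _) _.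
  move=> x xJ; apply: leq_trans cT; apply: subset_leq_card.
  by apply/subsetP => y; rewrite unfold_in /Q xJ.
rewrite leq_mul //; case: (posnP #|W|) => [W0|W0]; last by rewrite leq_pexp2l ?max_card.
by have := max_card (mem (cover J)); rewrite W0 leqn0 => /eqP ->.
Qed.

(** If [T] is contained in the image of [F] under [f], then [T] is the image of some [J \subset F]
    with [#|J| = #|T|]. There are at most [2 ^ #|F|] such [J], and the hypothesis bounds the copies
    through [T] for each of them. *)
Lemma spread_copy_weight (R : archiRealFieldType) (W V : finType)
    (F : {set {set W}}) (D tau : R) :
  0 < tau -> 0 <= D ->
  (forall J : {set {set W}}, J \subset F -> J != set0 ->
     tau * #|V|%:R ^+ (#|W| - #|cover J|) <= D * tau ^+ #|J|) ->
  spread #|F| (2 ^+ #|F| * #|W|%:R ^+ #|W| * D) tau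
    (copy_weight R F : {set {set V}} -> R).
Proof.
move=> tau0 D0 HJ; split=> [e|e|T T0].
- exact: ler0n.
- by move=> /copy_weight_neq0[f fi <-]; rewrite card_imset //; apply: imset_inj.
rewrite /wdeg sum_copy_weight.
pose X := #|W|%:R ^+ #|W| * (D * tau ^+ #|T| / tau).
have X0 : 0 <= X.
  by rewrite mulr_ge0 ?exprn_ge0 ?ler0n // divr_ge0 ?mulr_ge0 ?exprn_ge0 // ltW.
set S := [set f | _]; have S_le : (#|S| <= #|powerset F| * Num.truncn X)%N.
  apply: (card_le_fibers (Q := fun (J : {set {set W}}) (f : {ffun W -> V}) =>
     [&& J != set0, #|J| == #|T| & [set f @: A | A : {set W} in J] == T])).
    move=> f; rewrite inE => /andP[/injectiveP fi TF].
    exists [set A in F | f @: A \in T].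
      by rewrite powersetE; apply/subsetP => A; rewrite inE => /andP[].
    have fT : [set f @: A | A : {set W} in [set A in F | f @: A \in T]] = T.
      apply/setP => B; apply/imsetP/idP => [[A + ->]|BT]; first by rewrite inE => /andP[].
      have /imsetP[A AF BA] := subsetP TF B BT.
      by exists A => //; rewrite inE AF -BA.
    have cT : #|[set A in F | f @: A \in T]| = #|T|.
      by rewrite -{2}fT card_imset //; apply: imset_inj.
    by rewrite fT cT !eqxx !andbT -card_gt0 cT card_gt0.
  move=> J; rewrite powersetE => JF.
  have [J0|] := boolP ((J != set0) && (#|J| == #|T|)); last first.
    by move=> /negbTE nJ; rewrite (_ : [set _ | _] = set0) ?cards0 //; apply/setP => f; rewrite !inE andbA nJ.
  have /andP[J00 /eqP JT] := J0.
  apply: leq_trans (_ : (#|W| ^ #|W| * #|V| ^ (#|W| - #|cover J|)) <= _)%N.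
    apply: leq_trans (card_copies_through J T); apply: subset_leq_card.
    by apply/subsetP => f; rewrite !inE => /and3P[].
  rewrite truncn_ge_nat // natrM !natrX ler_wpM2l ?exprn_ge0 ?ler0n //.
  by rewrite ler_pdivlMr // mulrC -JT; apply: HJ.
rewrite -ler_pdivlMl //; apply: le_trans (_ : (#|powerset F| * Num.truncn X)%:R <= _).
  by rewrite ler_nat.
have -> : tau^-1 * (2 ^+ #|F| * #|W|%:R ^+ #|W| * D * tau ^+ #|T|) = 2 ^+ #|F| * X.
  by rewrite mulrC /X !mulrA.
by rewrite natrM card_powerset natrX ler_wpM2l ?exprn_ge0 // truncn_le.
Qed.

(** * Designs and conformality *)

(** The left side is the sum of ['C(j, k)] over [k < j < x]: there are [x - k.+1] terms, each at
    most ['C(x, k)]. *)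
Lemma bin_sub1_le (x k : nat) : (k < x)%N ->
  ('C(x, k.+1) - 1 <= (x - k.+1) * 'C(x, k))%N.
Proof.
elim: x => // x IH; rewrite ltnS leq_eqVlt => /predU1P[->|kx]; first by rewrite binn.
have h := IH kx; have h2 : ('C(x, k) <= 'C(x.+1, k))%N by apply: leq_bin2l.
have h3 : (0 < 'C(x, k.+1))%N by rewrite bin_gt0.
rewrite subSn // mulSn [in leqLHS]binS.
have h4 : ((x - k.+1) * 'C(x, k) <= (x - k.+1) * 'C(x.+1, k))%N by rewrite leq_mul2l h2 orbT.
lia.
Qed.

(** With [r = k.+1], this says that the ratio of ['C(x, r) - 1] to [x - r] does not decrease in [x].
    Passing from [t] to [t.+1] adds ['C(t, k)] to the numerator and 1 to the denominator, and
    ['C(t, k)] is at least the ratio at [x]. *)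
Lemma bin_balanced (x t k : nat) : (k < x)%N -> (x <= t)%N ->
  (('C(x, k.+1) - 1) * (t - k.+1) <= ('C(t, k.+1) - 1) * (x - k.+1))%N.
Proof.
move=> kx; elim: t => [|t IH]; first by lia.
rewrite leq_eqVlt => /predU1P[->//|xt]; have h := IH xt.
have kt : (k < t)%N by lia.
have h1 := bin_sub1_le kx.
have h2 : ((x - k.+1) * 'C(x, k) <= (x - k.+1) * 'C(t, k))%N.
  by rewrite leq_mul2l leq_bin2l ?orbT.
have h3 : (0 < 'C(t, k.+1))%N by rewrite bin_gt0.
rewrite subSn // mulnS binS.
have -> : ('C(t, k.+1) + 'C(t, k) - 1 = 'C(t, k) + ('C(t, k.+1) - 1))%N by lia.
by rewrite mulnDl leq_add // [leqRHS]mulnC (leq_trans h1 h2).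
Qed.

Lemma card_supersets (V : finType) (s : nat) (B : {set V}) :
  (#|[set A : {set V} | (#|A| == s) && (B \subset A)]| <= #|V| ^ (s - #|B|))%N.
Proof.
set S := [set A | _].
have inj : {in S &, injective (fun A => A :\: B)}.
  move=> A1 A2; rewrite !inE => /andP[_ BA1] /andP[_ BA2] E.
  by rewrite -(setID A1 B) -(setID A2 B) E (setIidPr BA1) (setIidPr BA2).
rewrite -(card_in_imset inj).
apply: leq_trans (_ : #|[set A : {set V} | #|A| == (s - #|B|)%N]| <= _)%N.
  apply: subset_leq_card; apply/subsetP => C /imsetP[A]; rewrite !inE => /andP[/eqP As BA] ->.
  by rewrite cardsD (setIidPr BA) As.
by rewrite card_draws bin_le_exp.
Qed.

(** For [r = 2] this is a pairwise balanced design without a block equal to the whole set. It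
    describes the traces that edges of a linear hypergraph leave on a copy of the complete graph
    contained in no edge. *)
Definition design (r t : nat) (P : {set {set 'I_t}}) : bool :=
  [forall X in P, (r <= #|X| < t)%N] &&
  [forall Y : {set 'I_t}, (#|Y| == r) ==> (#|[set X in P | Y \subset X]| == 1)].

Lemma design_sum (r t : nat) (P : {set {set 'I_t}}) : design r P ->
  (\sum_(X in P) 'C(#|X|, r) = 'C(t, r))%N.
Proof.
move=> /andP[_ /forallP cov].
transitivity (\sum_(X in P) \sum_(Y : {set 'I_t} | (Y \subset X) && (#|Y| == r)) 1)%N.
  by apply: eq_bigr => X _; rewrite sum1dep_card cards_draws.
rewrite (exchange_big_dep (fun Y : {set 'I_t} => #|Y| == r)) /=; last by move=> X Y _ /andP[].
rewrite -[in RHS](card_ord t) -card_draws -sum1dep_card; apply: eq_bigr => Y Yr.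
rewrite sum1dep_card; have /eqP E := implyP (cov Y) Yr; apply: etrans E.
by apply: eq_card => X; rewrite !inE Yr andbT.
Qed.

(** A single block would have to contain as many [r]-sets as the whole [t]-set, although it is
    smaller. The second block supplies the extra factor [z] in [design_prod_le]. *)
Lemma design_card (r t : nat) (P : {set {set 'I_t}}) :
  (0 < r)%N -> (r < t)%N -> design r P -> (1 < #|P|)%N.
Proof.
move=> r0 rt dP; have sumP := design_sum dP; rewrite ltnNge; apply/negP => /card_le1_eqP P1.
have Ct : (0 < 'C(t, r))%N by rewrite bin_gt0 ltnW.
have [P0|[X XP]] := set_0Vmem P; first by move: Ct; rewrite -sumP P0 big_set0.
have /andP[rX Xt] : (r <= #|X| < t)%N.
  by case/andP: dP => /forallP/(_ X); rewrite XP.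
have PX : P = [set X] by apply/setP => Y; rewrite inE; apply/idP/eqP => [YP|->//]; apply: P1.
move: sumP; rewrite PX big_set1 => E.
have := @leq_bin2l #|X|.+1 t r Xt; rewrite -E -(prednK r0) binS prednK //.
have : (0 < 'C(#|X|, r.-1))%N by rewrite bin_gt0; lia.
lia.
Qed.

Definition overlaps (r : nat) (V : finType) (H : {set {set V}}) :
    {set {set V} * {set V}} :=
  [set AB : {set V} * {set V} |
    [&& AB.1 \in H, AB.2 \in H, AB.1 != AB.2 & (r <= #|AB.1 :&: AB.2|)%N]].

(* [f] embeds a t-set; [g X] is an edge that meets it exactly in the image of [X].
   Outside [P] the value of [g] is fixed so that configurations can be counted. *)
Definition trace_pred (s t : nat) (V : finType) (f : {ffun 'I_t -> V})
    (P : {set {set 'I_t}}) (X : {set 'I_t}) : pred {set V} :=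
  if X \in P then [pred A : {set V} | (#|A| == s) && (f @^-1: A == X)]
  else pred1 set0.

Definition config (r s t : nat) (V : finType) (f : {ffun 'I_t -> V})
    (P : {set {set 'I_t}}) (g : {ffun {set 'I_t} -> {set V}}) : bool :=
  [&& injectiveb f, design r P & g \in family (trace_pred s f P)].

Definition configs (r s t : nat) (V : finType) (H : {set {set V}}) :
    {set {ffun 'I_t -> V} * {set {set 'I_t}} * {ffun {set 'I_t} -> {set V}}} :=
  [set x | config r s x.1.1 x.1.2 x.2 && (x.2 @: x.1.2 \subset H)].

Lemma config_trace (r s t : nat) (V : finType) (f : {ffun 'I_t -> V})
    (P : {set {set 'I_t}}) (g : {ffun {set 'I_t} -> {set V}}) (X : {set 'I_t}) :
  config r s f P g -> X \in P -> #|g X| = s /\ f @^-1: g X = X.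
Proof.
move=> /and3P[_ _ /familyP/(_ X)]; rewrite /trace_pred => gX XP; move: gX.
by rewrite XP inE => /andP[/eqP ? /eqP ?].
Qed.

(** Deleting every edge of an overlapping pair gives linearity. If some complete copy lay in no
    remaining edge, the traces of size at least [r] left on it by remaining edges would form a
    design, because linearity makes the cover of each [r]-set unique. These edges would then form a
    configuration and would have been deleted. A configuration has at most [2 ^ t] edges. *)
Lemma linear_conformal_subgraph (r s t : nat) (V : finType) (H : {set {set V}}) :
  (r < t)%N -> uniform s H ->
  exists H0 : {set {set V}}, [/\ H0 \subset H, linear_hgraph r H0, conformal r t H0
    & (#|H| <= #|H0| + (#|overlaps r H| + #|configs r s t H| * 2 ^ t))%N].
Proof.
move=> rt uH.
pose R1 := [set AB.1 | AB in overlaps r H].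
pose R2 := \bigcup_(x in configs r s t H) (x.2 @: x.1.2).
exists (H :\: (R1 :|: R2)).
have sub : H :\: (R1 :|: R2) \subset H by apply: subsetDl.
have lin : linear_hgraph r (H :\: (R1 :|: R2)).
  move=> B Br; apply/card_le1_eqP => A1 A2; rewrite !inE.
  move=> /andP[/andP[/norP[nR1 _] A1H] BA1] /andP[/andP[_ A2H] BA2].
  apply/eqP; apply: contraNT nR1 => A12; apply/imsetP; exists (A1, A2) => //.
  rewrite inE /= A1H A2H eq_sym A12 /= -Br; apply: subset_leq_card.
  by rewrite subsetI BA1 BA2.
split=> //; last first.
  rewrite -(cardsID (R1 :|: R2) H) addnC leq_add2l.
  apply: leq_trans (subset_leq_card (subsetIr _ _)) _.
  apply: leq_trans (leq_card_setU _ _) _; apply: leq_add; first exact: leq_imset_card.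
  apply: (card_le_fibers (Q := fun (x : {ffun 'I_t -> V} * {set {set 'I_t}} * {ffun {set 'I_t} -> {set V}})
    (A : {set V}) => A \in x.2 @: x.1.2)).
    by move=> A /bigcupP[x xc Ax]; exists x.
  move=> x _; apply: leq_trans (_ : #|x.2 @: x.1.2| <= _)%N.
    by apply: subset_leq_card; apply/subsetP => A; rewrite inE.
  apply: leq_trans (leq_imset_card _ _) _.
  rewrite -[in leqRHS](card_ord t) -cardsT -card_powerset powersetT.
  by apply: subset_leq_card; apply: subsetT.
move=> f [finj fcopy]; apply: contrapT => nof.
set H0 := H :\: _ in sub lin fcopy nof.
have cov (Y : {set 'I_t}) : #|Y| = r -> exists2 A, A \in H0 & f @: Y \subset A.
  move=> Yr; have := fcopy Y; rewrite !inE Yr eqxx => /(_ isT) /andP[_ /existsP[A /andP[AH YA]]].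
  by exists A.
pose P := [set X : {set 'I_t} | (r <= #|X|)%N & [exists A in H0, f @^-1: A == X]].
pose g := [ffun X : {set 'I_t} =>
  if X \in P then odflt set0 [pick A in H0 | f @^-1: A == X] else set0].
have gP X : X \in P -> g X \in H0 /\ f @^-1: g X = X.
  move=> XP; rewrite ffunE XP; move: XP; rewrite inE => /andP[_ /existsP[A /andP[AH fA]]].
  by case: pickP => [A' /andP[? /eqP]|/(_ A)] //=; rewrite AH fA.
have dP : design r P.
  apply/andP; split; apply/forallP => X; apply/implyP.
    move=> XP; move: (XP); rewrite inE => /andP[-> _] /=.
    have [gH gX] := gP X XP; have := max_card (mem X); rewrite card_ord ltn_neqAle => ->; rewrite andbT.
    apply: contra_not_neq nof => Xt; exists (g X) => // i.
    have /setP/(_ i) : f @^-1: g X = setT.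
      by rewrite gX; apply/eqP; rewrite eqEcard finset.subsetT cardsT card_ord Xt leqnn.
    by rewrite !inE.
  move=> /eqP Xr; have [A AH XA] := cov X Xr.
  have XfA : X \subset f @^-1: A by apply/subsetP => i iX; rewrite inE (subsetP XA) ?imset_f.
  apply/cards1P; exists (f @^-1: A); apply/setP => Y; rewrite !inE; apply/andP/eqP.
    move=> [YP XY]; have YP' : Y \in P by rewrite inE.
    have [gH gY] := gP Y YP'.
    suff -> : A = g Y by [].
    have := lin (f @: X); rewrite card_imset // => /(_ Xr)/card_le1_eqP; apply; rewrite inE ?AH //.
    by rewrite gH; apply/subsetP => y /imsetP[i iX ->]; have := subsetP XY i iX; rewrite -{1}gY inE.
  move=> ->; rewrite XfA -Xr subset_leq_card //; split=> //; apply/existsP; exists A.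
  by rewrite AH eqxx.
have cfg : (finfun f, P, g) \in configs r s t H.
  rewrite inE /=; apply/andP; split; last first.
    by apply/subsetP => A /imsetP[X /gP[gH _] ->]; apply: (subsetP sub).
  apply/and3P; split=> //; first by apply/injectiveP => i j; rewrite !ffunE => /finj.
  apply/familyP => X; rewrite /trace_pred; have [XP|XP] := boolP (X \in P); last first.
    by rewrite inE ffunE (negbTE XP).
  have [gH gX] := gP X XP; rewrite inE (uH _ (subsetP sub _ gH)) eqxx /=; apply/eqP.
  by rewrite -[RHS]gX; apply/setP => i; rewrite !inE ffunE.
(* Any [r]-set [Y] yields a block of [P], hence an edge that is in [H0] and also in a deleted
   configuration. *)
have [Y _ Yr] : exists2 Y : {set 'I_t}, Y \subset setT & #|Y| = r.
  have : (0 < #|[set Y : {set 'I_t} | (Y \subset setT) && (#|Y| == r)]|)%N.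
    by rewrite cards_draws cardsT card_ord bin_gt0 ltnW.
  by move=> /card_gt0P[Y]; rewrite inE => /andP[? /eqP]; exists Y.
have [A AH YA] := cov Y Yr.
have XP : f @^-1: A \in P.
  rewrite inE -Yr subset_leq_card; last by apply/subsetP => i iY; rewrite inE (subsetP YA) ?imset_f.
  by apply/existsP; exists A; rewrite AH eqxx.
have [gH _] := gP _ XP; move: (gH); rewrite /H0 in_setD => /andP[/negP nR _].
case: nR; rewrite in_setU; apply/orP; right; apply/bigcupP; exists (finfun f, P, g) => //.
exact: imset_f.
Qed.

(** Choose the first edge, then an [r]-subset of it that lies in the second edge, then the second
    edge. *)
Lemma card_overlaps_complete (r s : nat) (V : finType) :
  (#|overlaps r [set A : {set V} | #|A| == s]|
     <= #|V| ^ s * (2 ^ s * #|V| ^ (s - r)))%N.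
Proof.
set U := [set A | _]; have cU : (#|U| <= #|V| ^ s)%N by rewrite card_draws bin_le_exp.
apply: leq_trans (_ : #|U| * (2 ^ s * #|V| ^ (s - r)) <= _)%N; last by rewrite leq_mul2r cU orbT.
apply: (card_le_fibers (Q := fun (A : {set V}) (AB : {set V} * {set V}) =>
  (AB.1 == A) && (AB \in overlaps r U))).
  by move=> AB ABo; exists AB.1; rewrite ?eqxx //; move: ABo; rewrite inE => /andP[].
move=> A; rewrite inE => /eqP As.
pose S := [set B : {set V} | (#|B| == s) && (r <= #|A :&: B|)%N].
apply: leq_trans (_ : #|[set (A, B) | B in S]| <= _)%N.
  apply: subset_leq_card; apply/subsetP => -[A' B]; rewrite !inE /= => /andP[/eqP ->].
  by move=> /and4P[_ /eqP Bs _ rAB]; apply/imsetP; exists B; rewrite // inE Bs eqxx.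
apply: leq_trans (leq_imset_card _ _) _.
apply: leq_trans (_ : #|[set Y : {set V} | (Y \subset A) && (#|Y| == r)]| * #|V| ^ (s - r) <= _)%N.
  apply: (card_le_fibers (Q := fun Y B : {set V} => (#|B| == s) && (Y \subset B))).
    move=> B; rewrite inE => /andP[-> rAB].
    have : (0 < #|[set Y : {set V} | (Y \subset A :&: B) && (#|Y| == r)]|)%N.
      by rewrite cards_draws bin_gt0.
    by move=> /card_gt0P[Y]; rewrite !inE subsetI => /andP[/andP[YA YB] Yr]; exists Y; rewrite ?inE ?YA.
  by move=> Y; rewrite inE => /andP[_ /eqP <-]; apply: card_supersets.
rewrite leq_mul2r; apply/orP; right; rewrite -As -card_powerset.
by apply: subset_leq_card; apply/subsetP => Y; rewrite !inE => /andP[].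
Qed.

Lemma card_trace_family (s t : nat) (V : finType) (f : {ffun 'I_t -> V})
    (P : {set {set 'I_t}}) : injective f ->
  (#|family (trace_pred s f P)| <= \prod_(X in P) #|V| ^ (s - #|X|))%N.
Proof.
move=> finj; rewrite card_family foldrE big_image /= (bigID (mem P)) /=.
rewrite [X in (_ * X)%N]big1 ?muln1 => [|X /negbTE XP]; last by rewrite /trace_pred XP card1.
apply: leq_prod => X XP; rewrite /trace_pred XP -(card_imset (mem X) finj).
apply: leq_trans (card_supersets s (f @: X)); apply: subset_leq_card; apply/subsetP => A.
rewrite !inE => /andP[-> /eqP fA] /=; apply/subsetP => y /imsetP[i iX ->].
by move: iX; rewrite -fA inE.
Qed.

(** A block is recovered from its edge as the trace, so distinct blocks have distinct edges; hence a
    configuration is present with probability exactly [p ^+ #|P|]. *)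
Lemma config_imset (r s t : nat) (V : finType) (f : {ffun 'I_t -> V})
    (P : {set {set 'I_t}}) (g : {ffun {set 'I_t} -> {set V}}) :
  config r s f P g -> uniform s (g @: P) /\ #|g @: P| = #|P|.
Proof.
move=> cfg; split; first by move=> A /imsetP[X XP ->]; case: (config_trace cfg XP).
apply: card_in_imset => X Y XP YP gXY.
by rewrite -(config_trace cfg XP).2 gXY (config_trace cfg YP).2.
Qed.

From mathcomp Require Import all_classical all_reals all_analysis.
Import numFieldNormedType.Exports.

(** * Expectations over the random hypergraph *)

Definition expect (R : realType) (n s : nat) (p : R)
    (f : {set {set 'I_n}} -> R) : R :=
  \sum_(H : {set {set 'I_n}} | `[< uniform s H >]) Hnsp_mass s p H * f H.

Lemma Hnsp_mass_ge0 (R : realType) (n s : nat) (p : R) (H : {set {set 'I_n}}) :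
  0 <= p <= 1 -> 0 <= Hnsp_mass s p H.
Proof.
by move=> /andP[p0 p1]; apply: prodr_ge0 => A _; case: ifP; rewrite ?subr_ge0.
Qed.

(** Independence of the edges: the expectation of a product of functions of single edges factors. *)
Lemma expect_prod (R : realType) (n s : nat) (p : R) (u v : {set 'I_n} -> R) :
  expect s p (fun H => \prod_(A : {set 'I_n} | #|A| == s) (if A \in H then u A else v A)) =
  \prod_(A : {set 'I_n} | #|A| == s) (p * u A + (1 - p) * v A).
Proof.
transitivity (\prod_(A : {set 'I_n})
    ((if #|A| == s then p * u A else 0) + (if #|A| == s then (1 - p) * v A else 1))); last first.
  by rewrite [RHS]big_mkcond; apply: eq_bigr => A _; case: ifP; rewrite ?add0r.
rewrite bigA_distr /expect big_mkcond /=; apply: eq_bigr => H _.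
case: ifPn => [/asboolP uH|/asboolP nuH].
  rewrite /Hnsp_mass -big_split /= big_mkcond; apply: eq_bigr => A _.
  case: ifPn => [_|nA]; first by case: ifP.
  by case: ifPn => // /uH /eqP; rewrite (negbTE nA).
have [A AH nA] : exists2 A, A \in H & #|A| != s.
  apply: contrapT => h; apply: nuH => A AH; apply/eqP.
  by apply: contrapT => /negP nA; apply: h; exists A.
by rewrite (bigD1 A) //= AH (negbTE nA) mul0r.
Qed.

Lemma expect_sum (R : realType) (n s : nat) (p : R) (I : finType) (P : pred I)
    (f : I -> {set {set 'I_n}} -> R) :
  expect s p (fun H => \sum_(i | P i) f i H) = \sum_(i | P i) expect s p (f i).
Proof.
by rewrite /expect exchange_big; apply: eq_bigr => H _; rewrite mulr_sumr.
Qed.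

Lemma expectZ (R : realType) (n s : nat) (p a : R) (f : {set {set 'I_n}} -> R) :
  expect s p (fun H => a * f H) = a * expect s p f.
Proof. by rewrite /expect mulr_sumr; apply: eq_bigr => H _; rewrite mulrCA. Qed.

Lemma expectD (R : realType) (n s : nat) (p : R) (f g : {set {set 'I_n}} -> R) :
  expect s p (fun H => f H + g H) = expect s p f + expect s p g.
Proof. by rewrite /expect -big_split; apply: eq_bigr => H _; rewrite mulrDr. Qed.

Lemma eq_expect (R : realType) (n s : nat) (p : R) (f g : {set {set 'I_n}} -> R) :
  (forall H, uniform s H -> f H = g H) -> expect s p f = expect s p g.
Proof. by move=> fg; apply: eq_bigr => H /asboolP uH; rewrite fg. Qed.

Lemma Hnsp_prob_le1 (R : realType) (n s : nat) (p : R) (X : set {set {set 'I_n}}) :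
  0 <= p <= 1 -> Hnsp_prob s p X <= 1.
Proof.
move=> p01; rewrite -[leRHS](Hnsp_prob_setT n s p) /Hnsp_prob big_mkcond [leRHS]big_mkcond.
apply: ler_sum => H _; case: asboolP => [[uH _]|_].
  by case: asboolP => // -[].
by case: ifP => // _; apply: Hnsp_mass_ge0.
Qed.

(** Markov's inequality, with [f] dominating the indicator of the failure of [X]. *)
Lemma Hnsp_prob_ge (R : realType) (n s : nat) (p : R)
    (X : set {set {set 'I_n}}) (f : {set {set 'I_n}} -> R) : 0 <= p <= 1 ->
  (forall H, uniform s H -> 0 <= f H) ->
  (forall H, uniform s H -> ~ X H -> 1 <= f H) ->
  1 - expect s p f <= Hnsp_prob s p X.
Proof.
move=> p01 f0 f1; rewrite lerBlDr -[leLHS](Hnsp_prob_setT n s p) /Hnsp_prob /expect.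
rewrite [leLHS]big_mkcond [X in X + _]big_mkcond [X in _ + X]big_mkcond -big_split.
apply: ler_sum => H _ /=; have m0 := @Hnsp_mass_ge0 R n s p H p01.
have [uH|nuH] := pselect (uniform s H); last first.
  by rewrite !asboolF ?addr0 // => -[].
rewrite !(asboolT uH) asboolT //; case: asboolP => [_|nX].
  by rewrite lerDl mulr_ge0 // f0.
by rewrite add0r ler_peMr // f1 // => XH; apply: nX.
Qed.

Lemma Hnsp_prob_cvg1 (R : realType) (s : nat) (p u : nat -> R)
    (X : forall n, set {set {set 'I_n}}) : (forall n, 0 <= p n <= 1) ->
  (\forall n \near \oo, exists f : {set {set 'I_n}} -> R,
     [/\ forall H, uniform s H -> 0 <= f H,
         forall H, uniform s H -> ~ X n H -> 1 <= f H
       & expect s (p n) f <= u n])%classic ->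
  (u n @[n --> \oo] --> (0 : R))%classic ->
  (Hnsp_prob s (p n) (X n) @[n --> \oo] --> (1 : R))%classic.
Proof.
move=> p01 near_f u0.
apply: (@squeeze_cvgr _ _ _ _ (fun n => 1 - u n) (fun=> 1)); last exact: cvg_cst.
- near=> n; rewrite Hnsp_prob_le1 // andbT.
  have [f [f0 f1 fu]] : exists f : {set {set 'I_n}} -> R,
     [/\ forall H, uniform s H -> 0 <= f H,
         forall H, uniform s H -> ~ X n H -> 1 <= f H
       & expect s (p n) f <= u n] by near: n.
  by apply: le_trans (Hnsp_prob_ge (p01 n) f0 f1); rewrite lerB.
- by have := cvgB (cvg_cst (1 : R)) u0; rewrite subr0; apply.
Unshelve. all: by end_near.
Qed.

(** The generating function of [#|H :&: Q|] on the event that [H] contains [A]. Taking [y] equal to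
    [expR 1] or [expR (-1)] gives both Chernoff tails. *)
Lemma expect_exp (R : realType) (n s : nat) (p y : R) (A Q : {set {set 'I_n}}) :
  uniform s A -> uniform s Q -> [disjoint A & Q] ->
  expect s p (fun H => (A \subset H)%:R * y ^+ #|H :&: Q|) =
  p ^+ #|A| * (1 + p * (y - 1)) ^+ #|Q|.
Proof.
move=> uA uQ dAQ; pose u B := if B \in Q then y else 1.
pose v (B : {set 'I_n}) : R := if B \in A then 0 else 1.
rewrite (@eq_expect _ _ _ _ _ (fun H =>
    \prod_(B : {set 'I_n} | #|B| == s) (if B \in H then u B else v B))); last first.
  move=> H uH; have [AH|] := boolP (A \subset H); last first.
    move=> /fintype.subsetPn[B BA BH]; rewrite mul0r (bigD1 B) /=; last by rewrite uA.
    by rewrite (negbTE BH) /v BA mul0r.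
  rewrite mul1r -prodr_const big_mkcond [RHS]big_mkcond; apply: eq_bigr => B _.
  rewrite inE /u /v; have [BH|BH] := boolP (B \in H).
    by rewrite (uH _ BH) eqxx.
  rewrite (_ : (B \in A) = false) ?if_same //.
  by apply: contraNF BH; apply: (fintype.subsetP AH).
rewrite expect_prod -2!prodr_const (big_mkcond (mem A)) (big_mkcond (mem Q)) -big_split.
rewrite /= big_mkcond; apply: eq_bigr => B _; rewrite /u /v.
have [BA|BA] := boolP (B \in A).
  by rewrite (uA _ BA) eqxx (disjointFr dAQ BA) mulr1 mulr0 addr0.
have [BQ|BQ] := boolP (B \in Q); first by rewrite (uQ _ BQ) eqxx mul1r; ring.
by rewrite !mulr1 addrC subrK if_same.
Qed.

Lemma expect_exp_le (R : realType) (n s : nat) (p y : R) (A Q : {set {set 'I_n}}) :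
  0 <= p <= 1 -> 0 <= y -> uniform s A -> uniform s Q -> [disjoint A & Q] ->
  expect s p (fun H => (A \subset H)%:R * y ^+ #|H :&: Q|) <=
  p ^+ #|A| * expR (p * (y - 1) * #|Q|%:R).
Proof.
move=> /andP[p0 p1] y0 uA uQ dAQ; rewrite expect_exp // ler_wpM2l ?exprn_ge0 //.
rewrite expRM_natr lerXn2r ?nnegrE ?expR_ge0 //; last exact: expR_ge1Dx.
by rewrite mulrBr mulr1 addrCA addr_ge0 ?mulr_ge0 // subr_ge0.
Qed.

Lemma expRN1_sub1_le (R : realType) : expR (-1) - 1 <= - (1 / 2) :> R.
Proof.
have e2 : 2 <= expR 1 :> R by apply: le_trans (expR_ge1Dx 1).
rewrite lerBlDr (_ : - (1 / 2) + 1 = 2^-1 :> R); last by lra.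
by rewrite expRN lef_pV2 ?posrE ?expR_gt0.
Qed.

(** * The Ramsey property *)

Lemma uniformP (s : nat) (V : finType) (H : {set {set V}}) :
  reflect (uniform s H) (H \subset [set A : {set V} | #|A| == s]).
Proof.
apply: (iffP fintype.subsetP) => [sub A /sub|uH A AH]; first by rewrite inE => /eqP.
by rewrite inE uH.
Qed.

Lemma sum_exp_card (R : comNzRingType) (T : finType) (U : {set T}) (z : R) :
  \sum_(A : {set T} | A \subset U) z ^+ #|A| = (1 + z) ^+ #|U|.
Proof.
rewrite -prodr_const big_mkcond (big_mkcond (mem U)) /=.
transitivity (\prod_(i : T) ((if i \in U then z else 0) + 1)); last first.
  by apply: eq_bigr => i _; case: ifP; rewrite ?add0r // addrC.
rewrite bigA_distr; apply: eq_bigr => A _.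
case: ifPn => [AU|/fintype.subsetPn[i iA iU]].
  rewrite -prodr_const big_mkcond; apply: eq_bigr => i _.
  by case: ifPn => // iA; rewrite (fintype.subsetP AU).
by rewrite (bigD1 i) //= iA (negbTE iU) mul0r.
Qed.

Lemma card_primal_le (r s : nat) (V : finType) (H : {set {set V}}) :
  uniform s H -> (#|primal r H| <= 2 ^ s * #|H|)%N.
Proof.
move=> uH; rewrite mulnC.
apply: (card_le_fibers (Q := fun A B : {set V} => B \subset A)).
  by move=> B; rewrite inE => /andP[_ /existsP[A /andP[AH BA]]]; exists A.
by move=> A AH; rewrite -(uH _ AH) -card_powerset.
Qed.

(** Once a cover is fixed, the number of fingerprints it supports is only exponential in its size.
    This is what avoids a logarithmic loss in the union bound. *)
Lemma card_ffun_primal (r s q : nat) (V : finType) (H : {set {set V}}) :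
  uniform s H ->
  (#|ffun_on (mem (powerset (primal r H))) : pred {ffun 'I_q -> {set {set V}}}|
     <= (2 ^ (q * 2 ^ s)) ^ #|H|)%N.
Proof.
move=> uH; rewrite card_ffun_on card_ord card_powerset -!expnM leq_pexp2l //.
by rewrite mulnC -mulnA leq_mul2l card_primal_le ?orbT.
Qed.

(* A summand with [A] covering the fingerprint [S] is at least 1 for a bad [H];
   the factor [expR (- b * #|A|)] makes the sum over all covers converge. *)
Definition fingerprint_weight (R : realType) (r n q : nat) (b k0 x : R)
    (Q : seq {set {set 'I_n}} -> {set {set 'I_n}})
    (A H : {set {set 'I_n}}) : R :=
  \sum_(S : {ffun 'I_q -> {set {set 'I_n}}} | S \in ffun_on (mem (powerset (primal r A))))
    expR (b * (k0 - #|A|%:R) + x) *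
    ((A \subset H)%:R * expR (-1) ^+ #|H :&: (Q (codom S) :\: A)|).

(** Each cover [A] supports at most [L ^+ #|A|] fingerprints, where [L] is [2 ^ (q * 2 ^ s)]. Each
    [Q S] keeps at least [g] members outside [A], which gives the factor [expR (- (p * g / 2))].
    Dropping the bound on [#|A|], the sum over covers is evaluated by the binomial theorem. *)
Lemma expect_fingerprints (R : realType) (r s n q : nat) (p b k0 x g : R)
    (Q : seq {set {set 'I_n}} -> {set {set 'I_n}}) :
  0 <= p <= 1 -> 
  (forall S, uniform s (Q S)) ->
  (forall S, g + k0 <= #|Q S|%:R) ->
  expect s p (fun H => \sum_(A : {set {set 'I_n}} |
       (A \subset [set B : {set 'I_n} | #|B| == s]) && (#|A|%:R <= k0))
     fingerprint_weight r q b k0 x Q A H) <=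
  expR (b * k0 + x - p * g / 2 + p * (2 ^ (q * 2 ^ s))%:R * expR (- b) * n%:R ^+ s).
Proof.
move=> p01 uQ Qg; have /andP[p0 p1] := p01; set L : R := (2 ^ _)%:R.
have y_le := expRN1_sub1_le R.
rewrite expect_sum.
pose U := [set B : {set 'I_n} | #|B| == s].
apply: le_trans (_ : \sum_(A : {set {set 'I_n}} | A \subset U)
    expR (b * k0 + x - p * g / 2) * (p * L * expR (- b)) ^+ #|A| <= _); last first.
  rewrite -mulr_sumr sum_exp_card [leRHS]expRD ler_wpM2l ?expR_ge0 //.
  have z0 : 0 <= p * L * expR (- b) by rewrite !mulr_ge0 ?expR_ge0.
  apply: le_trans (_ : expR (p * L * expR (- b)) ^+ #|U| <= _).
    by rewrite lerXn2r ?nnegrE ?expR_ge0 ?addr_ge0 // expR_ge1Dx.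
  rewrite -expRM_natr ler_expR ler_wpM2l // -natrX ler_nat card_draws card_ord.
  exact: bin_le_exp.
rewrite big_mkcondr /=; apply: ler_sum => A /uniformP uA.
case: ifP => [Ak|_]; last by rewrite mulr_ge0 ?expR_ge0 // exprn_ge0 // !mulr_ge0 ?expR_ge0.
rewrite expect_sum.
apply: le_trans (_ : \sum_(S : {ffun 'I_q -> {set {set 'I_n}}} | S \in ffun_on (mem (powerset (primal r A))))
   expR (b * (k0 - #|A|%:R) + x) * (p ^+ #|A| * expR (- (p * g / 2))) <= _).
  apply: ler_sum => S _; rewrite expectZ ler_wpM2l ?expR_ge0 //.
  apply: le_trans (expect_exp_le p01 _ uA _ _) _; rewrite ?expR_ge0 //.
  - by move=> B; rewrite inE => /andP[_ /uQ].
  - by rewrite disjoint_sym -finset.setI_eq0 finset.setIC; apply/eqP/finset.setP => B; rewrite !inE andbA andbN.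
  rewrite ler_wpM2l ?exprn_ge0 // ler_expR.
  have gQ : g <= #|Q (codom S) :\: A|%:R.
    rewrite -(lerD2r #|A|%:R); apply: le_trans (_ : g + k0 <= _); first by rewrite lerD2l.
    apply: le_trans (Qg (codom S)) _; rewrite -natrD ler_nat.
    by rewrite -(cardsID A (Q (codom S))) addnC leq_add2l subset_leq_card // subsetIr.
  have h1 := ler_wpM2l p0 gQ.
  have h2 := ler_wpM2r (ler0n R #|Q (codom S) :\: A|) (ler_wpM2l p0 y_le).
  apply: le_trans h2 _; lra.
rewrite sumr_const -[leLHS]mulr_natl.
apply: le_trans (_ : L ^+ #|A| * (expR (b * (k0 - #|A|%:R) + x) *
    (p ^+ #|A| * expR (- (p * g / 2)))) <= _).
  rewrite ler_wpM2r ?mulr_ge0 ?exprn_ge0 ?expR_ge0 // /L -natrX ler_nat.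
  exact: card_ffun_primal.
have E : expR (b * (k0 - #|A|%:R) + x) * expR (- (p * g / 2)) =
    expR (b * k0 + x - p * g / 2) * expR (- b) ^+ #|A|.
  by rewrite -expRM_natr -!expRD; congr expR; ring.
rewrite [X in L ^+ _ * X]mulrCA E !exprMn le_eqVlt; apply/predU1P; left.
by rewrite mulrA [LHS]mulrCA [_ ^+ _ * _]mulrC.
Qed.

(** * Bounds on the density $m_r$, and fingerprints of bad colourings *)

Lemma m_density_ge (R : realType) (r : nat) (W : finType) (F : {set {set W}})
    (X : {set W}) (J : {set {set W}}) :
  J \subset F -> (forall A, A \in J -> A \subset X) -> (r < #|X|)%N ->
  (#|J|%:R - 1) / (#|X|%:R - r%:R) <= m_density R r F.
Proof.
move=> JF JX rX.
rewrite /m_density; apply: (bigmax_sup (X, J)) => //=.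
by rewrite JF rX andbT /=; apply/forallP => A; apply/implyP/JX.
Qed.

Lemma m_density_ge0 (R : realType) (r : nat) (W : finType) (F : {set {set W}}) :
  0 <= m_density R r F.
Proof. exact: bigmax_ge_id. Qed.

Lemma card_le_cover (r : nat) (W : finType) (J : {set {set W}}) :
  uniform r J -> J != finset.set0 -> (r <= #|finset.cover J|)%N.
Proof.
move=> uJ /finset.set0Pn[A AJ]; rewrite -(uJ A AJ).
by apply: subset_leq_card; apply: (finset.bigcup_sup A).
Qed.

(** Clearing the denominator also admits the case of a cover with exactly [r] vertices, which the
    maximum excludes: then [J] is a single edge and both sides vanish. *)
Lemma m_density_cover (R : realType) (r : nat) (W : finType) (F J : {set {set W}}) :
  uniform r F -> J \subset F -> J != finset.set0 ->
  #|J|%:R - 1 <= m_density R r F * (#|finset.cover J|%:R - r%:R) :> R.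
Proof.
move=> uF JF J0.
have uJ : uniform r J by move=> A /(fintype.subsetP JF); apply: uF.
have Jc A : A \in J -> A \subset finset.cover J by move=> AJ; apply: (finset.bigcup_sup A).
have := card_le_cover uJ J0; rewrite leq_eqVlt => /predU1P[rc|rc].
  rewrite -rc subrr mulr0 subr_le0 (ler_nat R _ 1); apply/card_le1_eqP => A B AJ BJ.
  have all_cover C : C \in J -> C = finset.cover J.
    by move=> CJ; apply/eqP; rewrite eqEcard Jc //= -rc (uJ _ CJ).
  by rewrite (all_cover A) // (all_cover B).
rewrite -ler_pdivrMr ?subr_gt0 ?ltr_nat //; exact: m_density_ge.
Qed.

(** Two distinct edges span at most [2 r] vertices. The bound yields $m_r(F)>0$ and $1/m_r(F)\leq
    r$. *)
Lemma m_density_lower (R : realType) (r : nat) (W : finType) (F : {set {set W}}) :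
  uniform r F -> (2 <= #|F|)%N -> 1 <= m_density R r F * r%:R.
Proof.
move=> uF /card_gt1P[A [B [AF BF AB]]].
have JF : [set A; B] \subset F by rewrite finset.subUset !finset.sub1set AF.
have J0 : [set A; B] != finset.set0 by apply/finset.set0Pn; exists A; rewrite !inE eqxx.
apply: le_trans (_ : #|[set A; B]|%:R - 1 <= _).
  by rewrite cards2 AB /=; lra.
apply: le_trans (m_density_cover R uF JF J0) _.
rewrite ler_wpM2l ?m_density_ge0 // lerBlDr -natrD ler_nat.
rewrite /finset.cover finset.bigcup_setU !finset.big_set1; apply: leq_trans (leq_card_setU _ _) _.
by rewrite (uF _ AF) (uF _ BF).
Qed.

Lemma blue_transversal (r s n : nat) (W : finType) (F : {set {set W}})
    (H : {set {set 'I_n}}) : uniform s H ->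
  ~ arrows (primal r H) (complete r s) F ->
  exists B : {set {set 'I_n}}, [/\ B \subset primal r H,
     copies F B = finset.set0 & H :&: clean r s B = finset.set0].
Proof.
move=> uH /existsNP[c /not_orP[nred nblue]].
exists [set A in primal r H | ~~ c A]; split.
- by apply/fintype.subsetP => A; rewrite inE => /andP[].
- apply/eqP; apply: contra_notT nblue => /finset.set0Pn[f]; rewrite inE.
  move=> /andP[/injectiveP fi /forallP fF]; exists f; split=> // A AF.
  exact: implyP (fF A) AF.
apply/eqP; apply: contra_notT nred => /finset.set0Pn[A].
rewrite !inE => /and3P[AH /eqP As /forallP Ac].
exists (fun i => enum_val (cast_ord (esym As) i)); split.
  by move=> i j /enum_val_inj /cast_ord_inj.
move=> Y; rewrite inE => /eqP Yr; set B := imset _ _.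
have BA : B \subset A by apply/fintype.subsetP => x /imsetP[i _ ->]; apply: enum_valP.
have Br : #|B| = r by rewrite card_imset // => i j /enum_val_inj /cast_ord_inj.
have Bp : B \in primal r H by rewrite inE Br eqxx; apply/existsP; exists A; rewrite AH.
by have := Ac B; rewrite BA Br eqxx /= [X in ~~ X]inE Bp negbK /= => cB; rewrite inE Bp.
Qed.

Lemma primal_cover (r n q k : nat) (H : {set {set 'I_n}})
    (S : {ffun 'I_q -> {set {set 'I_n}}}) :
  (forall i, S i \subset primal r H) -> (forall i, (#|S i| <= k)%N) ->
  exists A : {set {set 'I_n}}, [/\ A \subset H, (#|A| <= q * k)%N
    & forall i, S i \subset primal r A].
Proof.
move=> Sp Sk; pose c (B : {set 'I_n}) := odflt B [pick A in H | B \subset A].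
have cP B : B \in primal r H -> [/\ #|B| = r, c B \in H & B \subset c B].
  rewrite inE /c => /andP[/eqP -> /existsP[A /andP[AH BA]]].
  by case: pickP => [A' /andP[]|/(_ A)] //=; rewrite AH BA.
exists (c @: \bigcup_i S i); split.
- by apply/fintype.subsetP => A /imsetP[B /finset.bigcupP[i _ /(fintype.subsetP (Sp i))/cP[]] _ + _ ->].
- apply: leq_trans (leq_imset_card _ _) _; rewrite -[X in (_ <= X * _)%N]card_ord -cardsT.
  apply: (card_le_fibers (Q := fun i B => B \in S i)).
    by move=> B /finset.bigcupP[i _ BS]; exists i.
  by move=> i _; apply: leq_trans (Sk i); apply: subset_leq_card; apply/fintype.subsetP => B; rewrite inE.
move=> i; apply/fintype.subsetP => B BS; have [Br cH Bc] := cP B (fintype.subsetP (Sp i) B BS).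
rewrite inE Br eqxx; apply/existsP; exists (c B); rewrite Bc andbT.
by apply: imset_f; apply/finset.bigcupP; exists i.
Qed.

(** The blue sets of a bad colouring are independent for [copy_weight], so a container with few
    copies of [F] holds them. Supersaturation makes many [s]-sets clean for the container, hence
    clean for the blue sets, and such [s]-sets are not edges of [H]. *)
Lemma ramsey_fingerprints (R : realType) (r s : nat) (W : finType)
    (F : {set {set W}}) : uniform r F -> (0 < r)%N -> (0 < #|F|)%N ->
  exists (q n0 : nat) (K tau0 c : R), [/\ 0 < K, 0 < tau0, 0 < c &
  forall (n : nat) (tau : R), (n0 <= n)%N -> (0 < n)%N -> 0 < tau -> tau <= tau0 ->
    (forall J : {set {set W}}, J \subset F -> J != finset.set0 ->
      tau * n%:R ^+ (#|W| - #|finset.cover J|) <=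
      n%:R ^+ #|W| / n%:R ^+ r * tau ^+ #|J|) ->
  exists Q : seq {set {set 'I_n}} -> {set {set 'I_n}},
  [/\ forall S, uniform s (Q S), forall S, c * n%:R ^+ s <= #|Q S|%:R
    & forall H : {set {set 'I_n}}, uniform s H ->
      ~ arrows (primal r H) (complete r s) F ->
      exists S, fingerprint q (K * tau * n%:R ^+ r) (primal r H) S /\
        H :&: Q S = finset.set0]].
Proof.
move=> uF r0 F0.
have [k [n0 super]] := supersaturation s uF.
pose a : R := 2 ^+ #|F| * #|W|%:R ^+ #|W|.
have W0 : (0 < #|W|)%N.
  have /fintype.card_gt0P[A AF] := F0.
  by apply: leq_trans (max_card (mem A)); rewrite (uF _ AF).
have a0 : 0 < a by rewrite mulr_gt0 ?exprn_gt0 // ltr0n.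
have k0 : 0 < k.+1%:R :> R by rewrite ltr0n.
(* This constant cancels the factor [a] of [spread_copy_weight]: a container holds fewer than
   [n ^ #|W| / k.+1] copies of [F], which rules out the second alternative of [supersaturation]. *)
have [|q [K [tau0 [K0 t0 cont]]]] := @containers R #|F|.-1 (k.+1%:R * a)^-1.
  by rewrite invr_gt0 mulr_gt0.
exists q, n0, K, tau0, k.+1%:R^-1; split; rewrite ?invr_gt0 // => n tau nn0 n0' tau_gt0 tau_le HJ.
have nR k' : 0 < n%:R ^+ k' :> R by rewrite exprn_gt0 // ltr0n.
pose D := n%:R ^+ #|W| / n%:R ^+ r : R.
have D0 : 0 < D by rewrite divr_gt0.
have sp : spread #|F|.-1.+1 (a * D) tau (copy_weight R F : {set {set 'I_n}} -> R).
  rewrite prednK //; apply: (spread_copy_weight tau_gt0 (ltW D0)).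
  by move=> J JF J0; rewrite card_ord; apply: HJ.
pose U := [set B : {set 'I_n} | #|B| == r].
have UN : #|U|%:R <= n%:R ^+ r :> R.
  by rewrite -natrX ler_nat card_draws card_ord bin_le_exp.
have [Cont contP] := cont _ _ U _ tau _ tau_gt0 tau_le (mulr_gt0 a0 D0) (nR r) UN sp.
have big_clean (G : {set {set 'I_n}}) : (#|copies F G| * k.+1 < n ^ #|W|)%N ->
    k.+1%:R^-1 * n%:R ^+ s <= #|clean r s G|%:R :> R.
  move=> small; rewrite ler_pdivrMl // -natrX -natrM ler_nat.
  have [|big] := super n G nn0; first by move=> /leq_trans; apply; rewrite leq_mul2r leqnSn orbT.
  by have := leq_trans small big; rewrite ltnNge mulnC leq_mul2l leqnSn orbT.
pose all_sets := clean r s (finset.set0 : {set {set 'I_n}}).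
(* An arbitrary list [S] need not give a container with many clean sets. The default [all_sets]
   keeps the lower bound on the size of [Q S] valid for every [S]. *)
exists (fun S => let X := clean r s (Cont S) in
  if k.+1%:R^-1 * n%:R ^+ s <= #|X|%:R :> R then X else all_sets).
have uc (G : {set {set 'I_n}}) : uniform s (clean r s G).
  by move=> A; rewrite inE => /andP[/eqP].
split=> [S|S|H uH nar].
- by rewrite /=; case: ifP => _; apply: uc.
- rewrite /=; case: ifP => // _; apply: big_clean.
  rewrite (_ : copies _ _ = finset.set0) ?cards0 ?mul0n ?expn_gt0 ?n0' //.
  apply/finset.setP => f; rewrite !inE; apply/negP => /andP[_ /forallP fF].
  have /fintype.card_gt0P[A AF] := F0.
  by have := implyP (fF A) AF; rewrite inE.
have [B [BH Bc HB]] := blue_transversal uH nar.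
have BU : B \subset U.
  by apply: fintype.subset_trans BH _; apply/fintype.subsetP => b; rewrite !inE => /andP[].
have iB : independent (copy_weight R F) B.
  move=> e eB; apply/eqP; apply: contraT => /copy_weight_neq0[f fi fe].
  have : f \in copies F B.
    rewrite inE; apply/andP; split; first exact/injectiveP.
    apply/forallP => A; apply/implyP => AF; apply: (fintype.subsetP eB).
    by rewrite -fe; apply: imset_f.
  by rewrite Bc inE.
have [S [[Ssz Sin] BS Sm]] := contP B iB BU.
exists S; split.
  split=> // X /Sin[XB Xk]; split=> //; exact: fintype.subset_trans XB BH.
rewrite /=; have -> : k.+1%:R^-1 * n%:R ^+ s <= #|clean r s (Cont S)|%:R :> R.
  apply: big_clean; rewrite -(ltr_nat R) natrM natrX -ltr_pdivlMr //.
  rewrite -wmass_copy_weight; apply: lt_le_trans Sm _.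
  rewrite le_eqVlt; apply/predU1P; left; rewrite /D; field.
  by rewrite !gt_eqF.
apply/eqP; rewrite -finset.subset0 -HB; apply: finset.setIS.
apply/fintype.subsetP => A; rewrite !inE => /andP[-> /forallP AC] /=.
apply/forallP => b; apply/implyP => bA; have := implyP (AC b) bA.
by apply: contra; apply: (fintype.subsetP BS).
Qed.

Lemma one_le_expR (R : realType) (x : R) : (1 <= expR x) = (0 <= x).
Proof. by rewrite -{1}expR0 ler_expR. Qed.

(** [f1] is at least 1 when [H] has at least [expR 1 * mu] edges. Otherwise, for a bad [H0], the
    edges of [H] in [Q S] all lie in [H :\: H0], so there are at most [x] of them, and the summand
    of [f2] for a cover of the fingerprint is at least 1. *)
Lemma exists_ramsey_weight (R : realType) (r s n q : nat) (W : finType)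
    (F : {set {set W}}) (p b beta c delta : R)
    (Q : seq {set {set 'I_n}} -> {set {set 'I_n}}) :
  0 <= p <= 1 -> 0 <= b -> 0 <= beta -> 0 <= delta ->
  (forall S, uniform s (Q S)) -> (forall S, c * n%:R ^+ s <= #|Q S|%:R) ->
  (forall H : {set {set 'I_n}}, uniform s H ->
     ~ arrows (primal r H) (complete r s) F ->
     exists S, fingerprint q beta (primal r H) S /\ H :&: Q S = finset.set0) ->
  q%:R * beta <= c / 2 * n%:R ^+ s ->
  exists f : {set {set 'I_n}} -> R,
  [/\ forall H, uniform s H -> 0 <= f H,
      forall H, uniform s H ->
        ~ (forall H0 : {set {set 'I_n}}, H0 \subset H ->
           (1 - delta) * #|H|%:R <= #|H0|%:R ->
           arrows (primal r H0) (complete r s) F) -> 1 <= f H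
    & expect s p f <= expR (- (p * n%:R ^+ s)) +
        expR (b * (q%:R * beta) + delta * (expR 1 * (p * n%:R ^+ s))
          - p * (c / 2 * n%:R ^+ s) / 2
          + p * (2 ^ (q * 2 ^ s))%:R * expR (- b) * n%:R ^+ s)].
Proof.
move=> p01 b0 beta0 delta0 uQ cQ fpQ kc; have /andP[p0 p1] := p01.
set mu := p * n%:R ^+ s; set k0 := q%:R * beta; set x := delta * _.
have x0 : 0 <= x by rewrite !mulr_ge0 ?expR_ge0 ?exprn_ge0.
pose U := [set B : {set 'I_n} | #|B| == s].
pose f1 (H : {set {set 'I_n}}) := expR (- (expR 1 * mu)) *
  ((finset.set0 \subset H)%:R * expR 1 ^+ #|H :&: U|) : R.
pose f2 (H : {set {set 'I_n}}) := \sum_(A : {set {set 'I_n}} |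
    (A \subset U) && (#|A|%:R <= k0)) fingerprint_weight r q b k0 x Q A H.
have f2t0 A H : 0 <= fingerprint_weight r q b k0 x Q A H.
  by apply: sumr_ge0 => S _; rewrite !mulr_ge0 ?exprn_ge0 ?expR_ge0.
have f10 H : 0 <= f1 H by rewrite !mulr_ge0 ?exprn_ge0 ?expR_ge0.
have f20 H : 0 <= f2 H by apply: sumr_ge0.
exists (fun H => f1 H + f2 H); split=> [H _|H uH|].
- exact: addr_ge0.
- move=> /existsNP[H0 /not_implyP[H0H /not_implyP[H0big nar]]].
  have [big|small] := leP (expR 1 * mu) #|H|%:R.
    rewrite ler_wpDr // /f1 finset.sub0set mul1r.
    rewrite (finset.setIidPl _); last exact/uniformP.
    by rewrite -expRM_natr -expRD one_le_expR mul1r addrC subr_ge0.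
  rewrite ler_wpDl //.
  have uH0 : uniform s H0 by move=> A /(fintype.subsetP H0H); apply: uH.
  have [S [[Ssz Sin] HQ]] := fpQ H0 uH0 nar.
  pose S' := [ffun i : 'I_q => nth finset.set0 S i].
  have S'S : codom S' = S.
    apply: (@eq_from_nth _ finset.set0) => [|i]; rewrite size_map -cardE card_ord // => iq.
    rewrite (nth_map (Ordinal iq)) ?size_enum_ord // ffunE.
    by rewrite nth_enum_ord.
  have S'in i : S' i \in S by rewrite ffunE mem_nth // Ssz.
  have [||A [AH Ak AS]] := @primal_cover r n q (Num.truncn beta) H S'.
  - move=> i; apply: fintype.subset_trans (Sin _ (S'in i)).1 _.
    apply/fintype.subsetP => B; rewrite !inE => /andP[-> /existsP[A /andP[AH BA]]] /=.
    by apply/existsP; exists A; rewrite (fintype.subsetP H0H).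
  - by move=> i; rewrite truncn_ge_nat // (Sin _ (S'in i)).2.
  have AU : A \subset U by apply: fintype.subset_trans AH _; apply/uniformP.
  have Ak0 : #|A|%:R <= k0.
    apply: le_trans (_ : (q * Num.truncn beta)%:R <= _); first by rewrite ler_nat.
    by rewrite natrM ler_wpM2l // truncn_le.
  rewrite /f2 (bigD1 A) /=; last by rewrite AU.
  rewrite ler_wpDr ?sumr_ge0 // /fingerprint_weight (bigD1 S') /=; last first.
    by apply/ffun_onP => i; rewrite powersetE.
  rewrite ler_wpDr ?sumr_ge0 //.
  rewrite AH mul1r S'S -expRM_natr -expRD one_le_expR mulN1r -addrA.
  rewrite addr_ge0 ?mulr_ge0 ?subr_ge0 //.
  have HQA : (#|H :&: (Q S :\: A)| <= #|H :\: H0|)%N.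
    apply: subset_leq_card; apply/fintype.subsetP => B; rewrite !inE => /and3P[BH _ BQ].
    rewrite BH andbT; apply: contraT => /negbNE BH0.
    by have := finset.in_set0 B; rewrite -HQ inE BH0 BQ.
  apply: le_trans (_ : #|H :\: H0|%:R <= _); first by rewrite ler_nat.
  rewrite cardsD (finset.setIidPr H0H) natrB ?subset_leq_card //.
  apply: le_trans (_ : delta * #|H|%:R <= _); first by move: H0big; rewrite mulrBl mul1r; lra.
  by rewrite ler_wpM2l // ltW.
rewrite expectD lerD //.
  rewrite expectZ; apply: le_trans (_ : expR (- (expR 1 * mu)) *
     (p ^+ #|(finset.set0 : {set {set 'I_n}})| * expR (p * (expR 1 - 1) * #|U|%:R)) <= _).
    rewrite ler_wpM2l ?expR_ge0 //; apply: expect_exp_le; rewrite ?expR_ge0 //.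
    - by move=> A; rewrite inE.
    - exact/uniformP.
    - by rewrite -finset.setI_eq0 finset.set0I.
  rewrite cards0 expr0 mul1r -expRD ler_expR.
  have Un : #|U|%:R <= n%:R ^+ s :> R.
    by rewrite -natrX ler_nat card_draws card_ord bin_le_exp.
  have e1 : 0 <= expR 1 - 1 :> R by rewrite subr_ge0 one_le_expR.
  have := ler_wpM2l (mulr_ge0 p0 e1) Un; rewrite /mu; lra.
apply: expect_fingerprints => // S.
by apply: le_trans (cQ S); rewrite /k0; lra.
Qed.

Lemma cvg_expRN_mul (R : realType) (a : R) (z : nat -> R) : 0 < a ->
  (z n @[n --> \oo] --> +oo)%classic ->
  (expR (- (a * z n)) @[n --> \oo] --> (0 : R))%classic.
Proof.
move=> a0 zoo; apply: (cvg_comp (fun n => a * z n) (fun x => expR (- x))); last exact: cvgr_expR.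
apply/cvgryPge => A; near=> n.
rewrite mulrC -ler_pdivrMr //; near: n; exact: cvgry_ge.
Unshelve. all: by end_near.
Qed.

Lemma one_le_powR (R : realType) (a x : R) : 1 <= a -> 0 <= x -> 1 <= a `^ x.
Proof. by move=> a1 x0; rewrite -(powRr0 a) ler_powR. Qed.

(** The exponent of [n] is the vertex excess of [J] minus its edge excess divided by the density,
    which [m_density_cover] shows to be nonnegative. *)
Lemma powR_density (R : realType) (r n : nat) (W : finType) (F J : {set {set W}}) :
  let tau : R := n%:R `^ (- (1 / m_density R r F)) in
  0 < m_density R r F -> (0 < n)%N -> uniform r F -> J \subset F -> J != finset.set0 ->
  1 <= n%:R ^+ (#|finset.cover J| - r) * tau ^+ #|J|.-1.
Proof.
move=> tau m0 n0 uF JF J0; set m := m_density R r F in tau m0 *.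
have J1 : (0 < #|J|)%N by rewrite card_gt0.
have uJ : uniform r J by move=> A /(fintype.subsetP JF); apply: uF.
rewrite -!powR_mulrn ?powR_ge0 // -powRrM -powRD; last by rewrite pnatr_eq0 -lt0n n0 implybT.
apply: one_le_powR; first by rewrite ler1n.
rewrite natrB ?card_le_cover // -subn1 natrB // mulNr subr_ge0 div1r mulrC ler_pdivrMr // mulrC.
exact: m_density_cover.
Qed.

Lemma theorem1p4_i (R : realType) (r s : nat) (W : finType) (F : {set {set W}}) :
  (r < s)%N -> (2 <= r)%N -> uniform r F -> (2 <= #|F|)%N ->
  exists2 delta : R, 0 < delta &
    forall p : nat -> R, (forall n, 0 <= p n <= 1) ->
      (p n * n%:R `^ (s%:R - r%:R + 1 / m_density R r F) @[n --> \oo] --> +oo)%classic ->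
      (Hnsp_prob s (p n)
        [set H : {set {set 'I_n}} |
          forall H0 : {set {set 'I_n}}, H0 \subset H ->
            (1 - delta) * #|H|%:R <= #|H0|%:R :> R ->
            arrows (primal r H0) (complete r s) F]
        @[n --> \oo] --> (1 : R))%classic.
Proof.
move=> rs r2 uF F2.
have [||q [n0 [K [tau0 [c [K0 t0 c0 fp]]]]]] := ramsey_fingerprints R s uF.
- by apply: leq_trans r2.
- by apply: leq_trans F2.
set m := m_density R r F.
have rm1 : 1 <= m * r%:R := m_density_lower R uF F2.
have r0 : 0 < r%:R :> R by rewrite ltr0n (leq_trans _ r2).
have m0 : 0 < m by rewrite -(pmulr_lgt0 _ r0) (lt_le_trans ltr01).
pose al := 1 / m.
have al0 : 0 < al by rewrite divr_gt0.
have al_r : al <= r%:R by rewrite ler_pdivrMr // mulrC.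
pose L : R := (2 ^ (q * 2 ^ s))%:R.
have L0 : 0 < L by rewrite ltr0n expn_gt0.
(* [b] and [delta] are chosen so that the cost of summing over covers and the cost of passing to
   [H0] are each at most [c / 32 * mu]. With the same bound [bk] for the fingerprint size, the gain
   [c / 4 * mu] still leaves more than [c / 8 * mu]. *)
pose b := 32 * L / c + 1.
have b1 : 1 <= b by rewrite lerDr divr_ge0 ?mulr_ge0 // ltW.
have b0 : 0 < b by apply: lt_le_trans b1.
have bL : L * expR (- b) <= c / 32.
  rewrite expRN ler_pdivrMr ?expR_gt0 //.
  apply: le_trans (_ : c / 32 * b <= _).
    rewrite /b mulrDr [X in X + _](_ : _ = L); last by field; rewrite gt_eqF.
    by rewrite lerDl mulr1 divr_ge0 // ltW.
  have eb : b <= expR b by apply: le_trans (expR_ge1Dx b); rewrite lerDr.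
  by rewrite ler_wpM2l // divr_ge0 // ltW.
pose delta := c / (32 * expR 1) : R.
have d0 : 0 < delta by rewrite divr_gt0 // mulr_gt0 // expR_gt0.
exists delta => // p p01 zoo.
pose z n := p n * n%:R `^ (s%:R - r%:R + al).
apply: (@Hnsp_prob_cvg1 _ _ _ (fun n => expR (- (1 * z n)) + expR (- (c / 8 * z n)))) => //;
  last first.
  rewrite -[X in (_ --> X)%classic]addr0; apply: cvgD; apply: cvg_expRN_mul => //.
  by rewrite divr_gt0.
near=> n.
have n_gt0 : (0 < n)%N by near: n; apply: nbhs_infty_ge.
have n1 : 1 <= n%:R :> R by rewrite ler1n.
have nn0 : (n0 <= n)%N by near: n; apply: nbhs_infty_ge.
pose tau : R := n%:R `^ (- al).
have tau_gt0 : 0 < tau by rewrite powR_gt0 // ltr0n.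
have tau_le : tau <= tau0.
  have big : tau0^-1 `^ m <= n%:R by near: n; apply: nbhs_infty_ger.
  rewrite /tau powRN invf_ple ?posrE ?powR_gt0 ?ltr0n //.
  have := ge0_ler_powR (ltW al0) _ _ big; rewrite !nnegrE powR_ge0 => /(_ isT (ler0n _ _)).
  by rewrite -powRrM /al mulrCA divff ?gt_eqF // mulr1 powRr1 // invr_ge0 ltW.
have npos k : 0 < n%:R ^+ k :> R by rewrite exprn_gt0 // ltr0n.
have [|Q [uQ cQ fpQ]] := fp n tau nn0 n_gt0 tau_gt0 tau_le.
  move=> J JF J0; have uJ : uniform r J by move=> A /(fintype.subsetP JF); apply: uF.
  have rc := card_le_cover uJ J0.
  have J1 : (0 < #|J|)%N by rewrite card_gt0.
  have := powR_density m0 n_gt0 uF JF J0; rewrite -/m -/al -/tau => dens.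
  rewrite -(prednK J1) exprS [leRHS]mulrCA ler_pM2l //.
  have -> : n%:R ^+ #|W| = n%:R ^+ (#|W| - #|finset.cover J|) *
      (n%:R ^+ (#|finset.cover J| - r) * n%:R ^+ r) :> R.
    by rewrite -!exprD subnK // subnK // max_card.
  rewrite -!mulrA [n%:R ^+ r * _]mulrA divff ?gt_eqF // mul1r.
  by rewrite ler_peMr // ltW.
have p0 : 0 <= p n by have /andP[] := p01 n.
have p1 : p n <= 1 by have /andP[] := p01 n.
pose mu := p n * n%:R ^+ s.
(* The order of magnitude of a fingerprint. Since [mu = z n * nr] and [z n] tends to infinity,
   fingerprints are negligible compared with [mu]. *)
pose nr : R := n%:R ^+ r * tau.
have nr1 : 1 <= nr.
  rewrite /nr -powR_mulrn // -powRD ?pnatr_eq0 -?lt0n ?n_gt0 ?implybT //.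
  by apply: one_le_powR => //; rewrite subr_ge0.
have mu_z : mu = z n * nr.
  rewrite /mu /z /nr -!powR_mulrn // -mulrA -!powRD ?pnatr_eq0 -?lt0n ?n_gt0 ?implybT //.
  by congr (_ * _ `^ _); ring.
have z0 : 0 <= z n by rewrite mulr_ge0 // powR_ge0.
have z_mu : z n <= mu by rewrite mu_z ler_peMr.
have z_big : b * (q%:R * K) * 32 / c <= z n.
  by near: n; apply: cvgry_ge.
have bk : b * (q%:R * (K * tau * n%:R ^+ r)) <= c / 32 * mu.
  rewrite mu_z (_ : b * _ = b * (q%:R * K) * nr); last by rewrite /nr; ring.
  rewrite [leRHS]mulrA ler_wpM2r ?(le_trans _ nr1) //.
  by move: z_big; rewrite ler_pdivrMr // => zb; lra.
have mu_n : mu <= n%:R ^+ s by rewrite /mu ler_piMl // ltW.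
have beta0 : 0 <= K * tau * n%:R ^+ r by rewrite !mulr_ge0 // ltW.
have [|f [f0 f1 fE]] := exists_ramsey_weight (p01 n) (ltW b0) beta0 (ltW d0) uQ cQ fpQ.
  apply: le_trans (_ : b * (q%:R * (K * tau * n%:R ^+ r)) <= _).
    by rewrite ler_peMl // mulr_ge0.
  apply: le_trans bk _; apply: le_trans (ler_wpM2l _ mu_n) _; first by rewrite divr_ge0 // ltW.
  by rewrite ler_wpM2r ?(ltW (npos _)) // ler_wpM2l ?(ltW c0) // lef_pV2 ?posrE // ler_nat.
exists f; split=> //.
apply: le_trans fE _; rewrite lerD // ler_expR; first by rewrite mul1r lerN2.
have dE : delta * (expR 1 * mu) = c / 32 * mu.
  by rewrite /delta; field; rewrite gt_eqF // expR_gt0.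
have Lmu : L * expR (- b) * mu <= c / 32 * mu.
  by rewrite ler_wpM2r // (le_trans z0).
have czmu : c / 8 * z n <= c / 8 * mu by rewrite ler_wpM2l // divr_ge0 // ltW.
have cmu : 0 <= c * mu by rewrite mulr_ge0 ?(ltW c0) // (le_trans z0).
rewrite -/mu dE.
have -> : p n * (c / 2 * n%:R ^+ s) / 2 = c / 4 * mu by rewrite /mu; field.
have -> : p n * (2 ^ (q * 2 ^ s))%:R * expR (- b) * n%:R ^+ s = L * expR (- b) * mu.
  by rewrite /mu /L; ring.
lra.
Unshelve. all: by end_near.
Qed.

(** * Linear conformal subhypergraphs *)

Lemma expect_subset (R : realType) (n s : nat) (p : R) (A : {set {set 'I_n}}) :
  uniform s A -> expect s p (fun H => (A \subset H)%:R) = p ^+ #|A|.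
Proof.
move=> uA; have u0 : uniform s (finset.set0 : {set {set 'I_n}}) by move=> B; rewrite inE.
have := @expect_exp R n s p 1 A finset.set0 uA u0.
rewrite -finset.setI_eq0 finset.setI0 cards0 expr0 mulr1 => <- //.
by apply: eq_expect => H _; rewrite expr1n mulr1.
Qed.

Lemma expect_overlaps_le (R : realType) (n r s : nat) (p : R) : 0 <= p <= 1 ->
  expect s p (fun H : {set {set 'I_n}} => #|overlaps r H|%:R) <=
  2 ^+ s * (p * n%:R ^+ s) * (p * n%:R ^+ (s - r)).
Proof.
move=> /andP[p0 _]; pose U := [set A : {set 'I_n} | #|A| == s].
rewrite (@eq_expect _ _ _ _ _ (fun H => \sum_(AB in overlaps r U)
    ([set AB.1; AB.2] \subset H)%:R)); last first.
  move=> H uH; rewrite -natr_sum -sum1_card; congr (_%:R).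
  rewrite big_mkcond [RHS]big_mkcond; apply: eq_bigr => AB _.
  rewrite !inE finset.subUset !finset.sub1set.
  case AH : (AB.1 \in H); last by rewrite /=; case: ifP.
  case BH : (AB.2 \in H); last by rewrite /=; case: ifP.
  by rewrite (uH _ AH) (uH _ BH) eqxx.
rewrite expect_sum.
apply: le_trans (_ : \sum_(AB in overlaps r U) p ^+ 2 <= _).
  apply: ler_sum => AB; rewrite !inE => /and4P[/eqP As /eqP Bs AB12 _].
  rewrite expect_subset ?cards2 ?AB12 // => A.
  by rewrite !inE => /orP[] /eqP ->.
rewrite sumr_const -[leLHS]mulr_natr.
have := card_overlaps_complete r s 'I_n; rewrite card_ord -(ler_nat R) !natrM !natrX => h.
apply: le_trans (ler_wpM2l (exprn_ge0 2 p0) h) _.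
by rewrite le_eqVlt; apply/predU1P; left; move: (2 ^+ s) (n%:R ^+ s) (n%:R ^+ (s - r)) => x y z; ring.
Qed.

(** There are at most [n ^ t] embeddings and [2 ^ (2 ^ t)] designs; for each pair, the choices of
    edges and their probabilities combine to the product bounded by [B]. *)
Lemma expect_configs_le (R : realType) (n r s t : nat) (p B : R) : 0 <= p <= 1 -> 0 <= B ->
  (forall P : {set {set 'I_t}}, design r P -> \prod_(X in P) (p * n%:R ^+ (s - #|X|)) <= B) ->
  expect s p (fun H : {set {set 'I_n}} => #|configs r s t H|%:R) <=
  2 ^+ (2 ^ t) * (n%:R ^+ t * B).
Proof.
move=> /andP[p0 _] B0 HB.
rewrite (@eq_expect _ _ _ _ _ (fun H => \sum_(x : {ffun 'I_t -> 'I_n} * {set {set 'I_t}} *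
    {ffun {set 'I_t} -> {set 'I_n}} | config r s x.1.1 x.1.2 x.2) (x.2 @: x.1.2 \subset H)%:R)); last first.
  move=> H uH; rewrite -natr_sum -sum1_card; congr (_%:R).
  rewrite big_mkcond [RHS]big_mkcond; apply: eq_bigr => x _; rewrite inE.
  by case: (config _ _ _ _ _) => //=; case: (_ \subset H).
rewrite expect_sum.
apply: le_trans (_ : \sum_(x : {ffun 'I_t -> 'I_n} * {set {set 'I_t}} *
    {ffun {set 'I_t} -> {set 'I_n}} | config r s x.1.1 x.1.2 x.2) p ^+ #|x.1.2| <= _).
  apply: ler_sum => -[[f P] g] /= cfg; have [ug cg] := config_imset cfg.
  by rewrite expect_subset // cg.
have -> : \sum_(x : {ffun 'I_t -> 'I_n} * {set {set 'I_t}} *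
    {ffun {set 'I_t} -> {set 'I_n}} | config r s x.1.1 x.1.2 x.2) p ^+ #|x.1.2| =
  \sum_(y : {ffun 'I_t -> 'I_n} * {set {set 'I_t}} | injectiveb y.1 && design r y.2)
   \sum_(g in family (trace_pred s y.1 y.2)) p ^+ #|y.2|.
  rewrite pair_big_dep /=; apply: eq_bigl => -[[f P] g] /=.
  by rewrite /config andbA.
apply: le_trans (_ : \sum_(y : {ffun 'I_t -> 'I_n} * {set {set 'I_t}}) B <= _); last first.
  rewrite sumr_const card_prod card_ffun !card_ord.
  rewrite -finset.cardsT -finset.powersetT card_powerset cardsT.
  rewrite -finset.cardsT -finset.powersetT card_powerset cardsT card_ord.
  by rewrite -[leLHS]mulr_natl natrM !natrX mulrCA mulrA.
rewrite big_mkcond; apply: ler_sum => -[f P] _ /=.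
case: ifP => // /andP[/injectiveP finj dP]; apply: le_trans (HB P dP).
rewrite sumr_const -[leLHS]mulr_natl big_split /= prodr_const mulrC ler_wpM2l ?exprn_ge0 //.
have := card_trace_family s P finj; rewrite card_ord -(ler_nat R) natr_prod.
by move=> /le_trans; apply; apply: ler_prod => X _; rewrite natrX exprn_ge0 //=.
Qed.

(** * The density of complete hypergraphs, and the deletion argument *)

Lemma complete_uniform (r t : nat) : uniform r (complete r t).
Proof. by move=> A; rewrite inE => /eqP. Qed.

Lemma card_complete (r t : nat) : #|complete r t| = 'C(t, r).
Proof. by rewrite card_draws card_ord. Qed.

Lemma card_complete_gt1 (r t : nat) : (0 < r)%N -> (r < t)%N -> (2 <= #|complete r t|)%N.
Proof.
move=> r0 rt; rewrite card_complete; apply: leq_trans (leq_bin2l r rt).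
by rewrite binSn; lia.
Qed.

(** A subgraph on [X] has at most ['C(#|X|, r)] edges, and by [bin_balanced] the ratio is largest
    for the whole [t]-set. *)
Lemma m_density_complete (R : realType) (r t : nat) : (0 < r)%N -> (r < t)%N ->
  m_density R r (complete r t) * (t%:R - r%:R) <= 'C(t, r)%:R - 1.
Proof.
move=> r0 rt; rewrite -ler_pdivlMr ?subr_gt0 ?ltr_nat //.
have Ct : (1 <= 'C(t, r))%N by rewrite bin_gt0 ltnW.
apply: bigmax_le => [|[X E] /= /and3P[EF /forallP EX rX]].
  by rewrite divr_ge0 // subr_ge0 ?ler_nat ?ler1n // ltnW.
have Xt : (#|X| <= t)%N by have := max_card (mem X); rewrite card_ord.
have CX : (1 <= 'C(#|X|, r))%N by rewrite bin_gt0 ltnW.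
have EC : (#|E| <= 'C(#|X|, r))%N.
  rewrite -cards_draws; apply: subset_leq_card; apply/fintype.subsetP => A AE.
  rewrite inE (implyP (EX A) AE) /=.
  by have := fintype.subsetP EF A AE; rewrite inE.
apply: le_trans (_ : ('C(#|X|, r)%:R - 1) / (#|X|%:R - r%:R) <= _).
  by rewrite ler_wpM2r ?invr_ge0 ?subr_ge0 ?ler_nat 1?ltnW // lerB // ler_nat.
rewrite ler_pdivrMr ?subr_gt0 ?ltr_nat // mulrAC ler_pdivlMr ?subr_gt0 ?ltr_nat //.
rewrite -(natrB R CX) -(natrB R Ct) -(natrB R (ltnW rX)) -(natrB R (ltnW rt)) -!natrM ler_nat.
case: r r0 rt rX {EX EF Ct CX EC} => // k _ kt kX.
by apply: bin_balanced => //; apply: ltnW.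
Qed.

Lemma design_prod_le (R : realType) (r s t n : nat) (p : R) (P : {set {set 'I_t}}) :
  let z := p * n%:R `^ (s%:R - r%:R + 1 / m_density R r (complete r t)) in
  (0 < n)%N -> (0 < r)%N -> (r < t)%N -> (t <= s)%N -> 0 <= p -> z <= 1 ->
  design r P ->
  n%:R ^+ t * \prod_(X in P) (p * n%:R ^+ (s - #|X|)) <= p * n%:R ^+ s * z.
Proof.
move=> z n0 r0 rt ts p0 z1 dP.
set m := m_density R r (complete r t) in z z1 *.
pose tau : R := n%:R `^ (- (1 / m)).
have r0R : 0 < r%:R :> R by rewrite ltr0n.
have m0 : 0 < m.
  rewrite -(pmulr_lgt0 _ r0R); apply: lt_le_trans ltr01 _.
  exact: m_density_lower (@complete_uniform r t) (card_complete_gt1 r0 rt).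
have nR : 0 < n%:R :> R by rewrite ltr0n.
have n1 : 1 <= n%:R :> R by rewrite ler1n.
have tau0 : 0 < tau by rewrite powR_gt0.
have tau_ge0 := ltW tau0.
have z0 : 0 <= z by rewrite mulr_ge0 // powR_ge0.
have rs : (r <= s)%N by lia.
have pz : p * n%:R ^+ (s - r) = z * tau.
  rewrite /z /tau -mulrA -powRD ?(gt_eqF nR) ?implybT //.
  by rewrite addrK -natrB // powR_mulrn.
have Xle X : X \in P -> p * n%:R ^+ (s - #|X|) <= z * tau ^+ 'C(#|X|, r).
  move=> XP; have /andP[rX Xt] : (r <= #|X| < t)%N.
    by case/andP: dP => /forallP/(_ X); rewrite XP.
  pose J := [set Y : {set 'I_t} | (Y \subset X) && (#|Y| == r)].
  have cJ : #|J| = 'C(#|X|, r) by rewrite cards_draws.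
  have JF : J \subset complete r t.
    by apply/fintype.subsetP => Y; rewrite !inE => /andP[].
  have J0 : J != finset.set0 by rewrite -card_gt0 cJ bin_gt0.
  have JX : (#|finset.cover J| <= #|X|)%N.
    apply: subset_leq_card; apply/finset.bigcupsP => Y; rewrite inE => /andP[] //.
  have := powR_density m0 n0 (@complete_uniform r t) JF J0; rewrite -/m -/tau cJ => d1.
  have d2 : 1 <= n%:R ^+ (#|X| - r) * tau ^+ 'C(#|X|, r).-1.
    apply: le_trans d1 _; rewrite ler_wpM2r ?exprn_ge0 // ler_weXn2l //.
    exact: leq_sub2r.
  have -> : 'C(#|X|, r) = ('C(#|X|, r).-1).+1 by rewrite prednK // bin_gt0.
  rewrite exprS mulrA -pz.
  have -> : (s - r = (s - #|X|) + (#|X| - r))%N.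
    by rewrite addnBA // subnK // (leq_trans (ltnW Xt)).
  by rewrite exprD -!mulrA mulrA ler_peMr // mulr_ge0 ?exprn_ge0 // ltW.
have P2 := design_card r0 rt dP.
have prodP : \prod_(X in P) (p * n%:R ^+ (s - #|X|)) <= z ^+ 2 * tau ^+ 'C(t, r).
  apply: le_trans (_ : \prod_(X in P) (z * tau ^+ 'C(#|X|, r)) <= _).
    by apply: ler_prod => X XP; rewrite Xle // mulr_ge0 ?exprn_ge0 // ltW.
  rewrite big_split /= prodr_const -expr_sum (design_sum dP).
  by rewrite ler_wpM2r ?exprn_ge0 // ler_wiXn2l.
apply: le_trans (ler_wpM2l (exprn_ge0 t (ltW nR)) prodP) _.
have Ct : (1 <= 'C(t, r))%N by rewrite bin_gt0 ltnW.
have last : n%:R ^+ (t - r) * tau ^+ 'C(t, r).-1 <= 1 :> R.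
  rewrite -!powR_mulrn ?powR_ge0 ?ler0n // -powRrM -powRD ?(gt_eqF nR) ?implybT //.
  rewrite -[leRHS](powRr0 n%:R) ler_powR // natrB 1?ltnW // -subn1 natrB //.
  rewrite mulNr subr_le0 div1r mulrC ler_pdivlMr // mulrC.
  exact: m_density_complete.
have -> : n%:R ^+ t * (z ^+ 2 * tau ^+ 'C(t, r)) =
    (p * n%:R ^+ s * z) * (n%:R ^+ (t - r) * tau ^+ 'C(t, r).-1).
  rewrite -[in LHS](prednK Ct) [tau ^+ _.+1]exprS.
  have -> : n%:R ^+ s = n%:R ^+ (s - r) * n%:R ^+ r :> R by rewrite -exprD subnK.
  have -> : n%:R ^+ t = n%:R ^+ (t - r) * n%:R ^+ r :> R by rewrite -exprD subnK // ltnW.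
  rewrite [p * _]mulrA pz expr2.
  by move: (n%:R ^+ (t - r)) (n%:R ^+ r) (tau ^+ _) => x y w; ring.
by rewrite ler_piMr // mulr_ge0 // mulr_ge0 ?exprn_ge0 // ltW.
Qed.

(** [f1] handles the event that [H] has at most [c * mu] edges. Otherwise failure means that more
    than [eps * (c * mu)] edges are deleted, which Markov's inequality for [rem] controls. The mean
    number of edges is at least [4 * c * mu], so the Chernoff exponent is at most
    [c * mu - 2 * c * mu]. *)
Lemma exists_deletion_weight (R : realType) (r s t n : nat) (p c eps : R) :
  let mu := p * n%:R ^+ s in
  let z := p * n%:R `^ (s%:R - r%:R + 1 / m_density R r (complete r t)) in
  (0 < r)%N -> (r < t)%N -> (t <= s)%N -> (0 < n)%N -> 0 <= p <= 1 -> z <= 1 ->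
  0 < c -> 0 < eps -> 0 < mu -> 4 * c * n%:R ^+ s <= 'C(n, s)%:R ->
  exists f : {set {set 'I_n}} -> R,
  [/\ forall H, uniform s H -> 0 <= f H,
      forall H, uniform s H ->
        ~ (exists H0 : {set {set 'I_n}}, [/\ H0 \subset H, linear_hgraph r H0,
             conformal r t H0 & (1 - eps) * #|H|%:R <= #|H0|%:R]) -> 1 <= f H
    & expect s p f <= expR (- (c * mu)) +
        (2 ^+ s + 2 ^+ t * 2 ^+ (2 ^ t)) / c * (z / eps)].
Proof.
move=> mu z r0 rt ts n0 p01 z1 c0 eps0 mu0 cC; have /andP[p0 p1] := p01.
pose U := [set B : {set 'I_n} | #|B| == s].
pose rem (H : {set {set 'I_n}}) : R := #|overlaps r H|%:R + 2 ^+ t * #|configs r s t H|%:R.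
pose f1 (H : {set {set 'I_n}}) := expR (c * mu) *
  ((finset.set0 \subset H)%:R * expR (-1) ^+ #|H :&: U|) : R.
have rem0 H : 0 <= rem H by rewrite addr_ge0 // mulr_ge0 ?exprn_ge0.
have f10 H : 0 <= f1 H by rewrite !mulr_ge0 ?exprn_ge0 ?expR_ge0.
have ecm : 0 < eps * (c * mu) by rewrite mulr_gt0 // mulr_gt0.
exists (fun H => f1 H + (eps * (c * mu))^-1 * rem H); split=> [H _|H uH|].
- by rewrite addr_ge0 // mulr_ge0 // invr_ge0 ltW.
- move=> noH0; have [small|big] := leP #|H|%:R (c * mu).
    rewrite ler_wpDr ?mulr_ge0 ?invr_ge0 ?(ltW ecm) // /f1 finset.sub0set mul1r.
    rewrite (finset.setIidPl _); last exact/uniformP.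
    by rewrite -expRM_natr -expRD one_le_expR mulN1r subr_ge0.
  rewrite ler_wpDl // mulrC ler_pdivlMr // mul1r.
  have [H0 [sub lin conf cH]] := linear_conformal_subgraph rt uH.
  move: cH; rewrite -(ler_nat R) !natrD natrM natrX [_ * 2 ^+ t]mulrC -/(rem H) => cH.
  have nle : #|H0|%:R < (1 - eps) * #|H|%:R.
    by rewrite ltNge; apply/negP => le; apply: noH0; exists H0.
  have : eps * (c * mu) <= eps * #|H|%:R by rewrite ler_wpM2l // ltW.
  by move: nle; rewrite mulrBl mul1r; lra.
rewrite expectD lerD //.
  rewrite expectZ; apply: le_trans (_ : expR (c * mu) *
     (p ^+ #|(finset.set0 : {set {set 'I_n}})| * expR (p * (expR (-1) - 1) * #|U|%:R)) <= _).
    rewrite ler_wpM2l ?expR_ge0 //; apply: expect_exp_le; rewrite ?expR_ge0 //.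
    - by move=> A; rewrite inE.
    - exact/uniformP.
    - by rewrite -finset.setI_eq0 finset.set0I.
  rewrite cards0 expr0 mul1r -expRD ler_expR card_draws card_ord.
  have := ler_wpM2l p0 (expRN1_sub1_le R).
  move=> /(ler_wpM2r (ler0n R 'C(n, s))) h.
  have := ler_wpM2l p0 cC; rewrite /mu; lra.
rewrite expectZ expectD expectZ.
have rs : (r <= s)%N by lia.
have n1 : 1 <= n%:R :> R by rewrite ler1n.
have nR : 0 < n%:R :> R by rewrite ltr0n.
have z0 : 0 <= z by rewrite mulr_ge0 // powR_ge0.
have h1 : expect s p (fun H : {set {set 'I_n}} => #|overlaps r H|%:R) <= 2 ^+ s * (mu * z).
  apply: le_trans (expect_overlaps_le n r s p01) _.
  rewrite -mulrA ler_wpM2l ?exprn_ge0 // ler_wpM2l ?(ltW mu0) //.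
  rewrite /z ler_wpM2l // -powR_mulrn ?ler0n // ler_powR // natrB // lerDl.
  by rewrite divr_ge0 // m_density_ge0.
have h2 : expect s p (fun H : {set {set 'I_n}} => #|configs r s t H|%:R) <=
    2 ^+ (2 ^ t) * (mu * z).
  have nt : n%:R ^+ t != 0 :> R by rewrite expf_neq0 // gt_eqF.
  have -> : mu * z = n%:R ^+ t * (mu * z / n%:R ^+ t) by rewrite [RHS]mulrC divfK.
  apply: expect_configs_le => // [|P dP]; first by rewrite divr_ge0 ?mulr_ge0 ?exprn_ge0 // ltW.
  rewrite ler_pdivlMr ?exprn_gt0 // mulrC; exact: design_prod_le.
have h3 := ler_wpM2l (exprn_ge0 t (ler0n R 2)) h2.
have {h1 h3}h := lerD h1 h3.
have i0 : 0 <= (eps * (c * mu))^-1 by rewrite invr_ge0 ltW.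
apply: le_trans (ler_wpM2l i0 h) _; rewrite le_eqVlt; apply/predU1P; left.
move: (2 ^+ t) (2 ^+ s) (2 ^+ (2 ^ t)) => x y w; field.
by rewrite !gt_eqF.
Qed.

Lemma theorem1p4_ii (R : realType) (r s t : nat) (p : nat -> R) :
  (t <= s)%N -> (r < t)%N -> (2 <= r)%N -> (forall n, 0 <= p n <= 1) ->
  (p n * n%:R ^+ s @[n --> \oo] --> +oo)%classic ->
  (p n * n%:R `^ (s%:R - r%:R + 1 / m_density R r (complete r t))
    @[n --> \oo] --> (0 : R))%classic ->
  exists2 eps : nat -> R, (eps n @[n --> \oo] --> (0 : R))%classic &
    (Hnsp_prob s (p n)
      [set H : {set {set 'I_n}} |
        exists H0 : {set {set 'I_n}},
          [/\ H0 \subset H, linear_hgraph r H0, conformal r t H0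
            & (1 - eps n) * #|H|%:R <= #|H0|%:R :> R]]
      @[n --> \oo] --> (1 : R))%classic.
Proof.
move=> ts rt r2 p01 muoo z_cvg0.
set m := m_density R r (complete r t) in z_cvg0.
pose z n := p n * n%:R `^ (s%:R - r%:R + 1 / m).
have sz0 : (Num.sqrt (z n) @[n --> \oo] --> (0 : R))%classic.
  rewrite -[X in (_ --> X)%classic](@sqrtr0 R).
  exact: (cvg_comp _ _ z_cvg0 (@sqrt_continuous R 0)).
(* The square root balances the two requirements: both [eps n] and [z n / eps n] must tend to 0. *)
exists (fun n => Num.sqrt (z n)) => //.
(* By [expn_le_ffact], [n ^ s] is at most [d] times ['C(n, s)] once [n] is at least [2 * s]. *)
pose d : R := (2 ^ s * s`!)%:R.
have d0 : 0 < d by rewrite ltr0n muln_gt0 expn_gt0 fact_gt0.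
pose c : R := (4 * d)^-1; have c0 : 0 < c by rewrite invr_gt0 mulr_gt0.
pose K : R := (2 ^+ s + 2 ^+ t * 2 ^+ (2 ^ t)) / c.
apply: (@Hnsp_prob_cvg1 _ _ _ (fun n => expR (- (c * (p n * n%:R ^+ s))) + K * Num.sqrt (z n))) => //;
  last first.
  rewrite -[X in (_ --> X)%classic]addr0; apply: cvgD; first exact: cvg_expRN_mul.
  by rewrite -(mulr0 K); apply: cvgMr.
near=> n.
have n_gt0 : (0 < n)%N by near: n; apply: nbhs_infty_ge.
have n2s : (2 * s <= n)%N by near: n; apply: nbhs_infty_ge.
have mu1 : 1 <= p n * n%:R ^+ s by near: n; apply: cvgry_ge.
have mu0 : 0 < p n * n%:R ^+ s by apply: lt_le_trans mu1.
have nR : 0 < n%:R :> R by rewrite ltr0n.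
have pn0 : 0 < p n by move: mu0; rewrite pmulr_lgt0 // exprn_gt0.
have z0 : 0 < z n by rewrite mulr_gt0 // powR_gt0.
have z1 : z n <= 1.
  rewrite -(ger0_norm (ltW z0)); near: n; move/cvgr0Pnorm_le: z_cvg0; exact.
have cC : 4 * c * n%:R ^+ s <= 'C(n, s)%:R.
  have := expn_le_ffact n2s; rewrite -bin_ffact -(ler_nat R) natrX => h.
  have -> : 4 * c = d^-1 by rewrite /c invfM mulrA divff ?mul1r // pnatr_eq0.
  by rewrite ler_pdivrMl // /d -natrM -mulnA [(s`! * _)%N]mulnC.
have sz_gt0 : 0 < Num.sqrt (z n) by rewrite sqrtr_gt0.
have r0 : (0 < r)%N by apply: leq_trans r2.
have [f [f0 f1 fE]] := exists_deletion_weight r0 rt ts n_gt0 (p01 n) z1 c0 sz_gt0 mu0 cC.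
exists f; split=> //.
have zs : z n / Num.sqrt (z n) = Num.sqrt (z n).
  by rewrite -[X in X / _](sqr_sqrtr (ltW z0)) expr2 mulfK // gt_eqF.
by apply: le_trans fE _; rewrite -/m -/(z n) zs.
Unshelve. all: by end_near.
Qed.

Local Open Scope classical_set_scope.
Local Open Scope ring_scope.

Theorem theorem1p4 (R : realType) (r s t : nat)
    (ht : (t <= s)%N) (hrt : (r < t)%N) (hr : (2 <= r)%N) :
  (forall (W : finType) (F : {set {set W}}),
     uniform r F -> (2 <= #|F|)%N ->
     exists2 delta : R, 0 < delta &
       forall p : nat -> R, (forall n, 0 <= p n <= 1) ->
         p n * n%:R `^ (s%:R - r%:R + 1 / m_density R r F) @[n --> \oo] --> +oo ->
         Hnsp_prob s (p n)
           [set H : {set {set 'I_n}} |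
             forall H0 : {set {set 'I_n}}, H0 \subset H ->
               (1 - delta) * #|H|%:R <= #|H0|%:R :> R ->
               arrows (primal r H0) (complete r s) F]
           @[n --> \oo] --> (1 : R))
  /\
  (forall p : nat -> R, (forall n, 0 <= p n <= 1) ->
     p n * n%:R ^+ s @[n --> \oo] --> +oo ->
     p n * n%:R `^ (s%:R - r%:R + 1 / m_density R r (complete r t))
       @[n --> \oo] --> (0 : R) ->
     exists2 eps : nat -> R, eps n @[n --> \oo] --> (0 : R) &
       Hnsp_prob s (p n)
         [set H : {set {set 'I_n}} |
           exists H0 : {set {set 'I_n}},
             [/\ H0 \subset H, linear_hgraph r H0, conformal r t H0
               & (1 - eps n) * #|H|%:R <= #|H0|%:R :> R]]
         @[n --> \oo] --> (1 : R)).
Proof.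
split=> [W F uF F2|p p01 mu z].
  by apply: theorem1p4_i => //; apply: leq_trans ht.
exact: theorem1p4_ii.
Qed.
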